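(* Let $m \geq 2$ and $n \geq 3$ be integers and write $r = m(4m+3n-10)\big((m-1)(4m+3n-10)+1\big)$. Let $G \leq \mathrm{Homeo}(\mathfrak{C})$ be a simple vigorous group. Let $C$ be a clopen set such that $\emptyset \subsetneq C \subsetneq \mathfrak{C}$ and $[C]_G$ is even. Let $(\sigma, \tau) \in \mathcal{S}(G_C)$ and let $(\alpha, \beta) = \Phi_{m,n}(G, C, \sigma, \tau)$. Then the following hold: (i) $\alpha$ has small support and order $m$; (ii) $\beta$ has small support and order $n$; (iii) $(\alpha\beta)^{\beta^{-2}\alpha^{-1}\beta^{-2}}$ setwise stabilises $C$ and $(\alpha\beta)^{\beta^{-2}\alpha^{-1}\beta^{-2}}|_C = \sigma|_C$; (iv) $(\alpha\beta)^{\beta^{-2}\alpha^{-1}\beta^{-1}}$ setwise stabilises $C$ and $(\alpha\beta)^{\beta^{-2}\alpha^{-1}\beta^{-1}}|_C = \tau|_C$; (v) if $(\sigma,\tau) \in \mathcal{S}_m(G_C)$, then $[((\alpha\beta)^{\beta^{-2}\alpha^{-1}\beta^{-2}})^r, ((\alpha\beta)^{\beta^{-2}\alpha^{-1}\beta^{-1}})^r] = [\sigma^r, \tau^r]$; (vi) if $(\sigma,\tau) \in \mathcal{S}_{m,r}(G_C)$, then $\{\alpha, \beta\}$ is a strongly minimal generating set of $G$ of size two; (vii) if $(\sigma,\tau) \in \mathcal{S}_{m,r}(G_C)$, then there are involutions $\gamma, \delta \in G$ satisfying $\beta = \gamma\delta$ such that $\{\alpha, \gamma, \delta\}$ is a strongly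 minimal generating set of $G$ of size three.
   Context: Conventions: $\mathfrak{C}$ is Cantor space, groups act on the right, $x^y = y^{-1}xy$, $x^{-y} = (x^{-1})^y$, $[x,y] = x^{-1}y^{-1}xy$, $|x|$ is the order of $x$, $\mathrm{Supp}(x)$ is the set of points moved by $x$. A group $G \leq \mathrm{Homeo}(\mathfrak{C})$ is vigorous if for every clopen $A \subseteq \mathfrak{C}$ and all proper nonempty clopen $B, C \subsetneq A$ there exists $\gamma \in G$ with $B\gamma \subseteq C$ and $\gamma$ fixing $\mathfrak{C} \setminus A$ pointwise. For $U \subseteq \mathfrak{C}$, the rigid stabiliser $G_U$ is the subgroup of elements of $G$ fixing $\mathfrak{C}\setminus U$ pointwise. An element of $G$ has small support if it lies in $G_U$ for some clopen $U \subsetneq \mathfrak{C}$. Evenness. For a clopen set $\emptyset \subsetneq U \subsetneq \mathfrak{C}$ write $[U]_G = \{U\gamma \mid \gamma \in G\}$. For $G$ simple vigorous, the set of such classes is an abelian group under $[U]_G + [W]_G = [U\mu \cup W\nu]_G$, where $\mu, \nu \in G$ are any elements with $U\mu \cap W\nu = \emptyset$ and $U\mu \cup W\nu \neq \mathfrak{C}$. The class $[U]_G$ is even if $[U]_G = [W]_G + [W]_G$ for some clopen $\emptyset \subsetneq W \subsetneq \mathfrak{C}$. The sets $\mathcal{S}$. For a proper nonempty clopen set $C$: $\mathcal{S}(G_C) = \{(\sigma,\tau) \in G_C \times G_C \mid \sigma\tau$ has small support$\}$, where small support for elements of $G_C$ is meant relative to $C$, i.e. $\sigma\tau \in G_U$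 for some clopen $U \subsetneq C$; $\mathcal{S}_m(G_C) = \{(\sigma,\tau) \in \mathcal{S}(G_C) \mid |\sigma\tau| = m\}$; $\mathcal{S}_{m,r}(G_C) = \{(\sigma,\tau) \in \mathcal{S}_m(G_C) \mid G_C = \langle\sigma,\tau\rangle$ and $[\sigma^r,\tau^r] \neq 1\}$. Enacting permutations. If $U$ is clopen with $\emptyset \subsetneq U \subsetneq \mathfrak{C}$, $\gamma_1,\dots,\gamma_k \in G$ and $U\gamma_1,\dots,U\gamma_k$ are pairwise disjoint, then for $g \in \mathrm{Sym}(k)$ the element enacting the permutation $U\gamma_i \mapsto U\gamma_{ig}$ (written in cycle notation) is the homeomorphism that restricts to $\gamma_i^{-1}\gamma_{ig}$ on each $U\gamma_i$ and fixes all other points. (It depends on the elements $\gamma_i$, not just on the sets $U\gamma_i$.) The pair $\Phi_{m,n}(G,C,\sigma,\tau)$, for $m \geq 2$, $n \geq 3$, $G$ simple vigorous, $C$ proper nonempty clopen with $[C]_G$ even and $(\sigma,\tau)\in\mathcal{S}(G_C)$, is a pair $(\alpha,\beta) \in G \times G$ constructed as follows; there are choices involved in the construction and these can be made arbitrarily. Subscripts are finite sequences of nonnegative integers, written by concatenation. Write $m' = m-1$, $n' = n-1$. Let $X = (\{10,11,20,21\}\times\{2,\dots,m'\}) \sqcup (\{0,1,2\}\times\{0,\dots,n'\})$ (the first part is empty if $m=2$). Let $\gamma_{00} = 1$ and for $x \in X\setminus\{00\}$ fix $\gamma_x \in G$ such that $\mathfrak{C} = \bigsqcup_{x\in X} C\gamma_x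 \sqcup E$ (disjoint union) for a nonempty clopen set $E$. Let $Y = (\{00,01\}\times\{0,\dots,m'\})\setminus\{000\}$, and for $y \in Y$ fix $\gamma_y \in G$ such that the sets $E\gamma_y$ are pairwise disjoint and $\bigsqcup_{y\in Y}E\gamma_y \subseteq C\setminus\mathrm{Supp}(\sigma\tau)$. Let $$\alpha = \tau^{-\gamma_{11}}\tau^{\gamma_{12}}\sigma^{-\gamma_{21}}\sigma^{\gamma_{22}}\pi_1\pi_2\pi_3,$$ where $\pi_1,\pi_2,\pi_3 \in G$ respectively enact $(C\gamma_{01}\ C\gamma_{10}\ C\gamma_{102}\ \cdots\ C\gamma_{10m'})(C\gamma_{02}\ C\gamma_{20}\ C\gamma_{202}\ \cdots\ C\gamma_{20m'})$, $(C\gamma_{12}\ C\gamma_{11}\ C\gamma_{112}\ \cdots\ C\gamma_{11m'})(C\gamma_{22}\ C\gamma_{21}\ C\gamma_{212}\ \cdots\ C\gamma_{21m'})$, $(E\ E\gamma_{001}\ \cdots\ E\gamma_{00m'})(E\gamma_{010}\ E\gamma_{011}\ \cdots\ E\gamma_{01m'})$ (here $E$ is $E\cdot 1$), and let $\beta \in G$ enact $(C\gamma_{00}\ \cdots\ C\gamma_{0n'})(C\gamma_{10}\ \cdots\ C\gamma_{1n'})(C\gamma_{20}\ \cdots\ C\gamma_{2n'})$. (All these enacting elements do lie in $G$.) A generating set $X$ of a vigorous group $G \leq \mathrm{Homeo}(\mathfrak{C})$ is strongly minimal if every proper subset of $X$ fixes some nonempty clopen subset of $\mathfrak{C}$ pointwise.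 An involution is an element of order 2.
   Formalization: In (i), α is claimed to have small support except when n = 3, στ = 1 and the sets Eγ_y (y ∈ Y) cover C; for such choices α moves every point of Cantor space, so the claim as printed fails there. *)

(* Defs.v *)
From HB Require Import structures.
From mathcomp Require Import all_boot.
From mathcomp Require Import mathcomp_extra boolp classical_sets functions cardinality.
From mathcomp Require Import topology cantor.

Set Implicit Arguments.
Unset Strict Implicit.
Unset Printing Implicit Defensive.

Local Open Scope classical_set_scope.

(* Groups act on the right: [g p] is the image of the point [p] under [g]
   (written pg on paper), and [(g * h) p = h (g p)]. The image Ug of a set U
   is [g @` U]. With MathComp's conventions [x ^ y = y^-1 * (x * y)] and
   [[~ x, y] = x^-1 * (y^-1 * (x * y))]. *)

Record homeo (T : topologicalType) := Homeo {
  homeo_fun :> T -> T;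
  homeo_inv : T -> T;
  homeo_funK : cancel homeo_fun homeo_inv;
  homeo_invK : cancel homeo_inv homeo_fun;
  homeo_fun_continuous : continuous homeo_fun;
  homeo_inv_continuous : continuous homeo_inv }.

Section HomeoGroup.
Variable T : topologicalType.
Implicit Types g h : homeo T.

Lemma homeoP g h : (forall p, g p = h p) -> g = h.
Proof.
case: g h => [f f' fK f'K cf cf'] [k k' kK k'K ck ck'] /= fk.
have ? : f = k by apply: funext.
subst k.
have ? : f' = k' by apply: funext => p; apply: (can_inj fK); rewrite f'K k'K.
subst k'.
by congr Homeo; exact: Prop_irrelevance.
Qed.

HB.instance Definition _ := gen_eqMixin (homeo T).
HB.instance Definition _ := gen_choiceMixin (homeo T).

Definition homeo_one : homeo T :=
  @Homeo T id id (fun=> erefl) (fun=> erefl) (fun=> @cvg_id _ _) (fun=> @cvg_id _ _).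

Definition homeo_opp g : homeo T :=
  Homeo (@homeo_invK _ g) (@homeo_funK _ g)
    (@homeo_inv_continuous _ g) (@homeo_fun_continuous _ g).

Definition homeo_mul g h : homeo T :=
  Homeo (can_comp (@homeo_funK _ h) (@homeo_funK _ g))
    (can_comp (@homeo_invK _ g) (@homeo_invK _ h))
    (fun p => continuous_comp (@homeo_fun_continuous _ g p)
                              (@homeo_fun_continuous _ h (g p)))
    (fun p => continuous_comp (@homeo_inv_continuous _ h p)
                              (@homeo_inv_continuous _ g (homeo_inv h p))).

Fact homeo_mulA : associative homeo_mul.
Proof. by move=> g h k; apply: homeoP. Qed.
Fact homeo_mul1 : left_id homeo_one homeo_mul.
Proof. by move=> g; apply: homeoP. Qed.
Fact homeo_mulr1 : right_id homeo_one homeo_mul.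
Proof. by move=> g; apply: homeoP. Qed.
Fact homeo_mulV : left_inverse homeo_one homeo_opp homeo_mul.
Proof. by move=> g; apply: homeoP => p /=; rewrite homeo_invK. Qed.
Fact homeo_mulrV : right_inverse homeo_one homeo_opp homeo_mul.
Proof. by move=> g; apply: homeoP => p /=; rewrite homeo_funK. Qed.

HB.instance Definition _ := isGroup.Build (homeo T)
  homeo_mulA homeo_mul1 homeo_mulr1 homeo_mulV homeo_mulrV.

End HomeoGroup.

Local Open Scope group_scope.

Lemma homeoM (T : topologicalType) (g h : homeo T) p : (g * h) p = h (g p).
Proof. by []. Qed.

Lemma homeo1 (T : topologicalType) p : (1 : homeo T) p = p.
Proof. by []. Qed.

Section AbstractGroups.
Variable gT : groupType.
Implicit Types (G N S : set gT) (x : gT).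

Definition is_subgroup G :=
  [/\ G 1, (forall x y, G x -> G y -> G (x * y)) & (forall x, G x -> G x^-1)].

Definition generated S : set gT := smallest is_subgroup S.

Definition is_normal_in N G :=
  [/\ is_subgroup N, N `<=` G & forall x g, N x -> G g -> N (x ^ g)].

Definition is_simple G :=
  G <> [set 1] /\ forall N, is_normal_in N G -> N = [set 1] \/ N = G.

(* |x| = k, for a finite order k *)
Definition has_order x (k : nat) :=
  [/\ (0 < k)%N, x ^+ k = 1 & forall j : nat, (0 < j < k)%N -> x ^+ j <> 1].

Definition is_involution x := has_order x 2.

End AbstractGroups.

Local Notation CS := cantor_space.
Local Notation HCS := (homeo cantor_space).

Implicit Types (G : set HCS) (A B C E U V W : set CS).

Definition fixes_pointwise (g : HCS) U := forall p, U p -> g p = p.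

Definition Supp (g : HCS) : set CS := [set p | g p <> p].

Definition proper_clopen U := [/\ clopen U, U !=set0 & U <> setT].

Definition vigorous G :=
  forall A B C, clopen A -> clopen B -> clopen C ->
    B !=set0 -> C !=set0 -> B `<` A -> C `<` A ->
  exists g, [/\ G g, g @` B `<=` C & fixes_pointwise g (~` A)].

Definition rigid_stab G U : set HCS := [set g | G g /\ fixes_pointwise g (~` U)].

Definition small_support G (g : HCS) :=
  exists U, [/\ clopen U, U `<` setT & rigid_stab G U g].

Definition clopen_class G U : set (set CS) := [set V | exists2 g, G g & V = g @` U].

(* [V]_G = [U]_G + [W]_G; for simple vigorous G the class of the union does not
   depend on the choice of mu and nu. *)
Definition is_class_sum G U W V :=
  exists mu nu : HCS,
    [/\ G mu, G nu, (mu @` U) `&` (nu @` W) = set0,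
        (mu @` U) `|` (nu @` W) <> setT &
        clopen_class G V = clopen_class G ((mu @` U) `|` (nu @` W))].

Definition even_class G U := exists2 W, proper_clopen W & is_class_sum G W W U.

Definition setS G C : set (HCS * HCS) :=
  [set st | [/\ rigid_stab G C st.1, rigid_stab G C st.2 &
     exists U, [/\ clopen U, U `<` C & rigid_stab G U (st.1 * st.2)]]].

Definition setSm (m : nat) G C : set (HCS * HCS) :=
  [set st | setS G C st /\ has_order (st.1 * st.2) m].

Definition setSmr (m r : nat) G C : set (HCS * HCS) :=
  [set st | [/\ setSm m G C st, rigid_stab G C = generated [set st.1; st.2] &
     [~ st.1 ^+ r, st.2 ^+ r] <> 1]].

(* [pi] enacts the permutation [s] of the finite label set [D], where the
   label i stands for the set U gamma_i. *)
Definition enacts (I : eqType) U (gam : I -> HCS) (D : seq I) (s : I -> I)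
    (pi : HCS) :=
  (forall i, i \in D ->
     forall p, (gam i @` U) p -> pi p = ((gam i)^-1 * gam (s i)) p) /\
  (forall p, (forall i, i \in D -> ~ (gam i @` U) p) -> pi p = p).

(* The permutation given by a sequence of disjoint cycles, as [next c] is the
   identity off the cycle c. *)
Definition cycles_perm (I : eqType) (cs : seq (seq I)) (i : I) : I :=
  foldr next i cs.

Definition enacts_cycles (I : eqType) U (gam : I -> HCS) (cs : seq (seq I))
    (pi : HCS) :=
  enacts U gam (flatten cs) (cycles_perm cs) pi.

(* Subscripts are sequences of naturals: 10 is [:: 1; 0], 102 is [:: 1; 0; 2].
   The ranges {0,...,n'}, {0,...,m'} and {2,...,m'} are [iota 0 n], [iota 0 m]
   and [iota 2 (m - 2)]. *)
Section Labels.
Local Open Scope nat_scope.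
Variables m n : nat.

Definition labX : seq (seq nat) :=
  [seq rcons w k | w <- [:: [:: 1; 0]; [:: 1; 1]; [:: 2; 0]; [:: 2; 1]],
                   k <- iota 2 (m - 2)]
  ++ [seq [:: i; j] | i <- iota 0 3, j <- iota 0 n].

Definition labY : seq (seq nat) :=
  [seq y <- [seq rcons w k | w <- [:: [:: 0; 0]; [:: 0; 1]], k <- iota 0 m]
  | y != [:: 0; 0; 0]].

(* The labels w2, ..., wm' *)
Definition tail_labels (w : seq nat) : seq (seq nat) :=
  [seq rcons w k | k <- iota 2 (m - 2)].

Definition cycles1 : seq (seq (seq nat)) :=
  [:: [:: 0; 1] :: [:: 1; 0] :: tail_labels [:: 1; 0];
      [:: 0; 2] :: [:: 2; 0] :: tail_labels [:: 2; 0]].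

Definition cycles2 : seq (seq (seq nat)) :=
  [:: [:: 1; 2] :: [:: 1; 1] :: tail_labels [:: 1; 1];
      [:: 2; 2] :: [:: 2; 1] :: tail_labels [:: 2; 1]].

(* The label 000, which is in neither labX nor labY, stands for E = E1. *)
Definition cycles3 : seq (seq (seq nat)) :=
  [seq [seq rcons w k | k <- iota 0 m] | w <- [:: [:: 0; 0]; [:: 0; 1]]].

Definition cycles_beta : seq (seq (seq nat)) :=
  [seq [seq [:: i; j] | j <- iota 0 n] | i <- iota 0 3].

End Labels.

(* Admissible choices of the elements gamma_x, gamma_y and of the set E *)
Record Phi_choice (m n : nat) G C (sigma tau : HCS)
    (gam : seq nat -> HCS) E : Prop := PhiChoice {
  Phi_gam00 : gam [:: 0; 0]%N = 1;
  Phi_gamX : forall x, x \in labX m n -> G (gam x);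
  Phi_clopenE : clopen E;
  Phi_E0 : E !=set0;
  Phi_disjX : trivIset [set` labX m n] (fun x => gam x @` C);
  Phi_disjXE : (\bigcup_(x in [set` labX m n]) (gam x @` C)) `&` E = set0;
  Phi_cover : (\bigcup_(x in [set` labX m n]) (gam x @` C)) `|` E = setT;
  Phi_gam000 : gam [:: 0; 0; 0]%N = 1; (* not a choice: see cycles3 *)
  Phi_gamY : forall y, y \in labY m -> G (gam y);
  Phi_disjY : trivIset [set` labY m] (fun y => gam y @` E);
  Phi_subY :
    \bigcup_(y in [set` labY m]) (gam y @` E) `<=` C `\` Supp (sigma * tau) }.

(* (alpha, beta) is the value of Phi_{m,n}(G, C, sigma, tau) for the choices
   gam and E *)
Definition is_Phi (m n : nat) G C (sigma tau : HCS) (gam : seq nat -> HCS) E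
    (alpha beta : HCS) : Prop :=
  Phi_choice m n G C sigma tau gam E /\
  exists pi1 pi2 pi3 : HCS,
    [/\ [/\ G pi1, G pi2, G pi3 & G beta],
        [/\ enacts_cycles C gam (cycles1 m) pi1,
            enacts_cycles C gam (cycles2 m) pi2 &
            enacts_cycles E gam (cycles3 m) pi3],
        enacts_cycles C gam (cycles_beta n) beta &
        alpha = (tau^-1) ^ gam [:: 1; 1]%N * tau ^ gam [:: 1; 2]%N
              * (sigma^-1) ^ gam [:: 2; 1]%N * sigma ^ gam [:: 2; 2]%N
              * pi1 * pi2 * pi3].

(* The choices for which alpha moves every point: pi3 then moves all of E and
   of C, and pi1, pi2 move all the other C gamma_x. *)
Definition Phi_degenerate (m n : nat) C (sigma tau : HCS)
    (gam : seq nat -> HCS) E :=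
  [/\ n = 3, sigma * tau = 1 & \bigcup_(y in [set` labY m]) (gam y @` E) = C].

Definition strongly_minimal_generating G (X : set HCS) :=
  generated X = G /\
  forall Y : set HCS, Y `<` X ->
    exists U, [/\ clopen U, U !=set0 & forall g, Y g -> fixes_pointwise g U].

(* g setwise stabilises C and g|_C = h|_C *)
Definition stabilises_and_agrees (g h : HCS) C :=
  g @` C = C /\ forall p, C p -> g p = h p.

(* Main.v *)
(* A point of [C] outside the [E gamma_y] travels under [alpha * beta] once through
   all the pieces [C gamma_x] except [C gamma_12] and [C gamma_22], and comes back
   after N = 4m + 3n - 10 steps multiplied by (sigma tau)^-1; a point of some
   [E gamma_y] is passed on to the next one instead. Hence (alpha beta)^r is
   trivial off [C gamma_12] and [C gamma_22], on which alpha beta acts as tau and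
   sigma, and the two conjugates of (alpha beta)^r overlap only on [C]. This gives
   kappa = [sigma^r, tau^r] in H = <alpha, beta>.

   H realises every element of G_C on [C], so it contains the normal closure of
   kappa in G_C, and with it [G_W, G_W] for every clopen W properly inside [C].
   This property passes to unions of overlapping clopen sets and to images under H,
   so it spreads from [C] to the whole space. By simplicity the commutators of
   elements of small support generate G, whence H = G.

   Simplicity also shows that G is generated by elements of small support, and
   therefore that a homeomorphism that is locally in G agrees with an element of G
   outside any prescribed nonempty clopen set. Hence t^-1 t^h lies in G whenever t
   and h are locally in G and h moves the support of t off itself. As [C] is even,
   a reflection gamma of the cycles of beta has this form; beta = gamma delta with
   gamma and delta fixing different parts of [C]. *)
Require Import Defs.
From mathcomp Require Import all_boot.
From mathcomp Require Import mathcomp_extra boolp classical_sets functions cardinality.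
From mathcomp Require Import finmap zify.
From mathcomp Require Import topology cantor.

Set Implicit Arguments.
Unset Strict Implicit.
Unset Printing Implicit Defensive.

Local Open Scope classical_set_scope.
Local Open Scope group_scope.

Local Notation CS := cantor_space.
Local Notation HCS := (homeo cantor_space).

(** * Clopen sets and supports *)

Section CantorClopens.
Implicit Types (U V W : set CS) (p q : CS) (g h : HCS).

Lemma clopenD U V : clopen U -> clopen V -> clopen (U `\` V).
Proof. by move=> cU cV; rewrite setDE; apply: clopenI => //; exact: clopenC. Qed.

(** Cantor space is perfect: a clopen set equal to [{p}] would make [p] isolated. *)
Lemma nonempty_has_two_points U p :
  clopen U -> U p -> exists2 q, U q & q <> p.
Proof.
move=> [oU _] Up; have /perfectTP /(_ p) := cantor_perfect.
apply: contra_notP => /forall2NP H.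
suff -> : [set p] = U by [].
rewrite eqEsubset; split=> [_ -> //|q Uq].
by case: (H q) => // /contrapT.
Qed.

Lemma clopen_avoid U p : clopen U -> U !=set0 ->
  exists V, [/\ clopen V, V !=set0, V `<=` U & ~ V p].
Proof.
move=> cU [q0 Uq0].
have [q Uq /eqP qp] : exists2 q, U q & q <> p.
  have [<-|/eqP ?] := eqVneq q0 p; last by exists q0.
  exact: nonempty_has_two_points.
have [V [cV Vq Vp]] := @cantor_zero_dimensional q p qp.
exists (U `&` V); split; [exact: clopenI|by exists q|by move=> ? []|by case].
Qed.

Lemma clopen_split U : clopen U -> U !=set0 ->
  exists V, [/\ clopen V, V !=set0, V `<=` U & U `\` V !=set0].
Proof.
move=> cU [p Up]; have [V [cV V0 VU Vp]] := @clopen_avoid U p cU (ex_intro _ p Up).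
by exists V; split => //; exists p.
Qed.

Lemma homeoK g p : g^-1 (g p) = p.
Proof. exact: homeo_funK. Qed.

Lemma homeoVK g p : g (g^-1 p) = p.
Proof. exact: homeo_invK. Qed.

Lemma homeo_inj g p q : g p = g q -> p = q.
Proof. exact: (can_inj (homeoK g)). Qed.

Lemma homeo_imageP g U p : (g @` U) p <-> U (g^-1 p).
Proof.
split=> [[q Uq <-]|Up]; first by rewrite homeoK.
by exists (g^-1 p) => //; rewrite homeoVK.
Qed.

Lemma homeo_image g U : g @` U = (g^-1)%g @^-1` U.
Proof. by apply/seteqP; split=> p /homeo_imageP. Qed.

Lemma homeo_image_mem g U p : (g @` U) (g p) <-> U p.
Proof. by rewrite homeo_imageP homeoK. Qed.

Lemma clopen_image g U : clopen U -> clopen (g @` U).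
Proof.
move=> cU; rewrite homeo_image; apply: preimage_clopen => //.
exact: (@homeo_fun_continuous _ g^-1).
Qed.

Lemma clopen_preimage g U : clopen U -> clopen (g @^-1` U).
Proof. by move=> cU; apply: preimage_clopen => //; exact: (@homeo_fun_continuous _ g). Qed.

Definition supported g U := fixes_pointwise g (~` U).

Lemma supported_stable g U p : supported g U -> U p -> U (g p).
Proof.
move=> sg Up; apply: contrapT => Ugp.
by move: (sg _ Ugp) => /homeo_inj gp; apply: Ugp; rewrite gp.
Qed.

Lemma supportedM g h U : supported g U -> supported h U -> supported (g * h) U.
Proof. by move=> sg sh p Up; rewrite homeoM sg ?sh. Qed.

Lemma supportedV g U : supported g U -> supported g^-1 U.
Proof. by move=> sg p Up; rewrite -[in LHS](sg p Up) homeoK. Qed.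

Lemma supportedX g U k : supported g U -> supported (g ^+ k) U.
Proof.
by move=> sg; elim: k => [|k IH]; [rewrite expg0|rewrite expgS; exact: supportedM].
Qed.

Lemma supportedJ g h U : supported g U -> supported (g ^ h) (h @` U).
Proof.
move=> sg p Up; rewrite conjgE !homeoM sg ?homeoVK//.
by move=> ?; apply: Up; apply/homeo_imageP.
Qed.

Lemma supportedS g U V : U `<=` V -> supported g U -> supported g V.
Proof. by move=> UV sg p Vp; apply: sg => /UV. Qed.

Lemma disjoint_supports_commute g h U V : supported g U -> supported h V ->
  (forall p, U p -> ~ V p) -> commute g h.
Proof.
move=> sg sh UV; apply: homeoP => p; rewrite !homeoM.
have [Up|Up] := pselect (U p).
  by rewrite (sh p (UV _ Up)) sh//; apply: UV; exact: supported_stable.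
rewrite (sg p Up); have [Vp|Vp] := pselect (V p); last by rewrite sh// sg.
by rewrite sg// => /UV; apply; exact: supported_stable.
Qed.

(** [g * h^-1] is the identity on [U], so it commutes with [s]. *)
Lemma conj_agree g h s U : supported s U -> (forall p, U p -> g p = h p) ->
  s ^ g = s ^ h.
Proof.
move=> ss gh.
have c : commute s (g * h^-1).
  apply: (@disjoint_supports_commute _ _ U (~` U)) => // [p /contrapT Up|p Up].
    by rewrite homeoM gh// homeoK.
  exact.
have -> : g = g * h^-1 * h by rewrite mulgVK.
by rewrite conjgM; congr (_ ^ _); apply/eqP; rewrite conjg_fix; apply/commgP.
Qed.

End CantorClopens.

(** * Generated subgroups and closure properties *)

Section Subgroups.
Variable gT : groupType.
Implicit Types (H S : set gT).

Lemma generated_subgroup S : is_subgroup (generated S).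
Proof.
split=> [K [[]]|x y Sx Sy K [sK SK]|x Sx K [sK SK]] //; case: (sK) => K1 KM KV.
- by apply: KM; [exact: Sx (conj sK SK)|exact: Sy (conj sK SK)].
- by apply: KV; exact: Sx (conj sK SK).
Qed.

Lemma sub_generated S : S `<=` generated S.
Proof. by move=> x Sx K [_]; apply. Qed.

Lemma generated_sub S H : is_subgroup H -> S `<=` H -> generated S `<=` H.
Proof. by move=> sH SH x; apply; split. Qed.

Section Closure.
Variables (H : set gT) (sH : is_subgroup H).

Lemma subgroup1 : H 1. Proof. by case: sH. Qed.
Lemma subgroupM x y : H x -> H y -> H (x * y). Proof. by case: sH => _ + _; apply. Qed.
Lemma subgroupV x : H x -> H x^-1. Proof. by case: sH => _ _; apply. Qed.
Lemma subgroupJ x y : H x -> H y -> H (x ^ y).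
Proof. by move=> ? ?; rewrite conjgE; apply: subgroupM; [exact: subgroupV|exact: subgroupM]. Qed.
Lemma subgroupR x y : H x -> H y -> H [~ x, y].
Proof. by move=> ? ?; rewrite commgEl; apply: subgroupM; [exact: subgroupV|exact: subgroupJ]. Qed.
Lemma subgroupX x k : H x -> H (x ^+ k).
Proof.
by move=> Hx; elim: k => [|k IH]; rewrite ?expg0 ?expgS; [exact: subgroup1|exact: subgroupM].
Qed.

End Closure.
End Subgroups.

(** * Vigorous groups *)

Section Vigorous.
Variables (G : set HCS) (hG : is_subgroup G) (hvig : vigorous G).
Implicit Types (A B C D P U V W : set CS) (p q : CS) (g h x y : HCS).

Local Notation rs := (rigid_stab G).

Lemma rigid_stab_subgroup U : is_subgroup (rs U).
Proof.
split=> [|x y [Gx sx] [Gy sy]|x [Gx sx]].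
- by split; [exact: subgroup1|].
- by split; [exact: subgroupM|exact: supportedM].
- by split; [exact: subgroupV|exact: supportedV].
Qed.

Lemma rigid_stabJ U x h : rs U x -> G h -> rs (h @` U) (x ^ h).
Proof. by move=> [Gx sx] Gh; split; [exact: subgroupJ|exact: supportedJ]. Qed.

Lemma rigid_stabS U V x : U `<=` V -> rs U x -> rs V x.
Proof. by move=> UV [? sx]; split=> //; exact: supportedS sx. Qed.

(** Vigour in a pointwise form that also admits an empty [B] and [C = A]; the identity serves in
    both cases. *)
Lemma vigorous_into A B C : clopen A -> clopen B -> clopen C -> B `<=` A -> C `<=` A ->
  A `\` B !=set0 -> C !=set0 ->
  exists2 g, rs A g & forall p, B p -> C (g p).
Proof.
move=> cA cB cC BA CA [a [Aa Ba]] C0.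
have [[b Bb]|B0] := pselect (B !=set0); last first.
  by exists 1; [exact: subgroup1 (rigid_stab_subgroup A)|move=> p Bp; case: B0; exists p].
have [AC|nAC] := pselect (A `<=` C).
  by exists 1; [exact: subgroup1 (rigid_stab_subgroup A)|move=> p /BA /AC].
have [g [Gg gB sg]] := hvig cA cB cC (ex_intro _ b Bb) C0
  (conj BA (fun AB => Ba (AB _ Aa))) (conj CA nAC).
by exists g => // p Bp; apply: gB; exists p.
Qed.

(* The commutator [[x, y]] acts on [B] like [y], because [x] moves the support of
   [y] off [B]. *)
Lemma commutator_compress A B C : clopen A -> clopen B -> clopen C ->
  B `<=` A -> C `<=` A -> A `\` B !=set0 -> C !=set0 ->
  exists W x y, [/\ clopen W, W `<` A, rs W x, rs W y &
    forall p, B p -> C ([~ x, y] p)].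
Proof.
move=> cA cB cC BA CA AB0 C0.
(* The target is shrunk so that [B] and [C'] together leave part of [A] free: half of [C] outside
   [B] if that is nonempty, and [C] itself if it lies in [B]. *)
have [C' [cC' C'0 C'C Z0]] : exists C', [/\ clopen C', C' !=set0, C' `<=` C &
    A `\` (B `|` C') !=set0].
  have [CD0|CD0] := pselect ((C `\` B) !=set0).
    have [V [cV V0 VC [p [[Cp Bp] Vp]]]] := clopen_split (clopenD cC cB) CD0.
    exists V; split=> //; first by move=> q /VC[].
    by exists p; split; [exact: CA|case].
  exists C; split=> //; move: AB0 => [p [Ap Bp]]; exists p; split=> //.
  by case=> // Cp; apply: CD0; exists p.
(* The free part is cut in three: [Z1] receives [Y] under [x], [Z2] makes [Y] larger than [B], and
   [Z3] stays fixed by [x] and [y], so that [W] is smaller than [A]. *)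
have cZ : clopen (A `\` (B `|` C')) by apply: clopenD => //; exact: clopenU.
have [Z1 [cZ1 Z10 Z1Z Z0']] := clopen_split cZ Z0.
have [Z2 [cZ2 Z20 Z2Z Z30]] := clopen_split (clopenD cZ cZ1) Z0'.
set Z3 := (X in X !=set0) in Z30.
have cZ3 : clopen Z3 by apply: clopenD => //; exact: clopenD.
pose Y := B `|` C' `|` Z2.
have cY : clopen Y by do 2![apply: clopenU => //].
have [y ry yB] : exists2 y, rs Y y & forall p, B p -> C' (y p).
  apply: vigorous_into => //; [by move=> p ?; left; left|by move=> p ?; left; right|].
  move: Z20 => [p Z2p]; exists p; split; first by right.
  by move: (Z2Z _ Z2p) => [[_ h] _] Bp; apply: h; left.
pose W := A `\` Z3.
have YW : Y `<=` W.
  move=> p [[Bp|Cp]|Z2p]; split.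
  - exact: BA.
  - by case=> -[[_ h] _] _; apply: h; left.
  - exact/CA/C'C.
  - by case=> -[[_ h] _] _; apply: h; right.
  - by case: (Z2Z _ Z2p) => -[].
  - by case=> _; apply.
have cW : clopen W by exact: clopenD.
have Z1W : Z1 `<=` W.
  by move=> p Z1p; split; [case: (Z1Z _ Z1p)|case=> -[_]].
have Z1Y p : Z1 p -> ~ Y p.
  move=> Z1p; case: (Z1Z _ Z1p) => _ h; case; first exact: h.
  by move=> /Z2Z [].
have [x rx xY] : exists2 x, rs W x & forall p, Y p -> Z1 (x p).
  apply: vigorous_into => //; move: Z10 => [p Z1p]; exists p; split; first exact: Z1W.
  exact: Z1Y.
exists W, x, y; split => //.
- split; first by move=> p [].
  by move: Z30 => [p Z3p] /(_ p) []//; case: Z3p => -[[]].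
- exact: rigid_stabS ry.
move=> p Bp; rewrite commgEl conjgE !homeoM.
have nY : ~ Y (x^-1 p).
  by move=> /xY; rewrite homeoVK => /Z1Y; apply; left; left.
rewrite (supportedV ry.2) // homeoVK; exact/C'C/yB.
Qed.

(** * Spreading the commutators of rigid stabilisers *)

Section CommClosed.
Variables (H : set HCS) (sH : is_subgroup H) (HG : H `<=` G).

(** The inclusion of [W] is strict because a point of [A] outside [W] is what allows [W] to be
    compressed inside [A]. *)
Definition comm_closed A := forall W x y, clopen W -> W `<` A ->
  rs W x -> rs W y -> H [~ x, y].

Lemma comm_closedS A B : B `<=` A -> comm_closed A -> comm_closed B.
Proof.
move=> BA KA W x y cW [WB nBW]; apply: KA => //; split.
  exact: subset_trans BA.
by move=> AW; apply: nBW; exact: subset_trans AW.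
Qed.

Lemma rigid_stabJ_sub W V x h : G h -> (forall p, W p -> V (h p)) -> rs W x -> rs V (x ^ h).
Proof.
move=> Gh WV rx; apply: rigid_stabS (rigid_stabJ rx Gh).
by move=> _ [p Wp <-]; exact: WV.
Qed.

Lemma comm_closedJ A h : clopen A -> H h -> comm_closed A -> comm_closed (h @` A).
Proof.
move=> cA Hh KA W x y cW [WA nAW] rx ry.
rewrite -[x](conjgKV h) -[y](conjgKV h) -conjRg; apply: subgroupJ => //.
have Gh : G h^-1 by apply: subgroupV => //; exact: HG.
apply: (KA ((h^-1)%g @` W)); [exact: clopen_image| |exact: rigid_stabJ|exact: rigid_stabJ].
split=> [_ [q /WA[p Ap <-] <-]|AW]; first by rewrite homeoK.
by apply: nAW => _ [p /AW[q Wq <-] <-]; rewrite homeoVK.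
Qed.

(** The point [d] gives room for a commutator [k], taken from the rigid stabiliser of a proper part
    of [A] and hence in [H], that pushes the part of [W] in [A] into [Q], inside the overlap of [A]
    and [B]. Conjugation by [k] therefore carries [W] properly inside [B]: the point [e] is left
    out. *)
Lemma comm_closedU_half A B q d W x y : clopen A -> clopen B ->
  comm_closed A -> comm_closed B -> A q -> B q -> A d -> ~ W d ->
  clopen W -> W `<=` A `|` B -> rs W x -> rs W y -> H [~ x, y].
Proof.
move=> cA cB KA KB Aq Bq Ad Wd cW WAB rx ry.
have [Q [cQ Q0 QAB [e [[Ae Be] Qe]]]] := clopen_split (clopenI cA cB) (ex_intro _ q (conj Aq Bq)).
have AW0 : (A `\` (W `&` A)) !=set0 by exists d; split=> // -[].
have [V [u [v [cV VA ru rv kW]]]] := @commutator_compress A (W `&` A) Q cA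
  (clopenI cW cA) cQ (@subIsetr _ _ _) (fun p Qp => (QAB p Qp).1)
  AW0 Q0.
have Hk : H [~ u, v] by exact: KA VA ru rv.
have kfix : supported [~ u, v] A.
  have [_ ?] : rs V [~ u, v] by apply: subgroupR => //; exact: rigid_stab_subgroup.
  by apply: supportedS; first exact: VA.1.
set k := [~ u, v] in Hk kW kfix.
rewrite -[[~ x, y]](conjgK k); apply: subgroupJ => //; last exact: subgroupV.
rewrite conjRg; pose W' := Q `|` (B `\` A).
have kWW' p : W p -> W' (k p).
  move=> Wp; have [Ap|nAp] := pselect (A p); first by left; exact: kW.
  by right; rewrite kfix//; case: (WAB _ Wp).
apply: (KB W').
- by apply: clopenU => //; exact: clopenD.
- split; first by move=> p [/QAB[]|[]].
  by move=> /(_ e Be) [/Qe|[]].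
- by apply: rigid_stabJ_sub kWW' rx; exact: HG.
- by apply: rigid_stabJ_sub kWW' ry; exact: HG.
Qed.

Lemma comm_closedU A B : clopen A -> clopen B -> (A `&` B) !=set0 ->
  comm_closed A -> comm_closed B -> comm_closed (A `|` B).
Proof.
move=> cA cB [q [Aq Bq]] KA KB W x y cW [WAB nW] rx ry.
have [d ABd Wd] : exists2 d, (A `|` B) d & ~ W d.
  apply: contrapT => /forall2NP h; apply: nW => p ABp.
  by case: (h p) => // /contrapT.
case: ABd => ?.
  exact: (@comm_closedU_half A B q d W).
by apply: (@comm_closedU_half B A q d W) => //; rewrite setUC.
Qed.

End CommClosed.

(** * Consequences of simplicity: generation by elements of small support *)

Hypothesis hsimple : is_simple G.

(** Conjugation by [G] permutes the proper clopen sets [W], so the commutators from all [G_W]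
    generate a normal subgroup. It is not trivial, because some such commutator carries a set [B]
    into its complement; by simplicity it is [G]. *)
Lemma comm_closedT_sub H : is_subgroup H -> comm_closed H setT -> G `<=` H.
Proof.
move=> sH KT.
pose S := [set z | exists W x y, [/\ clopen W, W `<` setT, rs W x, rs W y & z = [~ x, y]]].
have SH : generated S `<=` H.
  by apply: generated_sub => // _ [W [x [y [cW WT rx ry ->]]]]; exact: KT rx ry.
have SG : generated S `<=` G.
  apply: generated_sub => // _ [W [x [y [cW WT [Gx _] [Gy _] ->]]]]; exact: subgroupR.
have SJ z g : S z -> G g -> S (z ^ g).
  move=> [W [x [y [cW [_ WT] rx ry ->]]]] Gg.
  exists (g @` W), (x ^ g), (y ^ g); split; rewrite ?conjRg//.
  - exact: clopen_image.
  - split=> // h; apply: WT => p _; apply/(homeo_image_mem g); exact: h.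
  - exact: rigid_stabJ.
  - exact: rigid_stabJ.
have nS : is_normal_in (generated S) G.
  split=> //; first exact: generated_subgroup.
  move=> z g + Gg; suff: generated S `<=` [set z | generated S (z ^ g)] by apply.
  have sS := generated_subgroup S.
  apply: generated_sub => [|x Sx]; last by apply: sub_generated; exact: SJ.
  split=> [|x y|x] /=; rewrite ?conj1g ?conjMg ?conjVg.
  - exact: subgroup1.
  - exact: subgroupM.
  - exact: subgroupV.
case: hsimple => _ /(_ _ nS) [S1|<-] //.
have [B [cB [b Bb] _ [c [_ Bc]]]] := clopen_split (@clopenT CS) (ex_intro _ point I).
have cBc : clopen (~` B) by rewrite -setTD; apply: clopenD => //; exact: clopenT.
have [W [x [y [cW WT rx ry xyB]]]] := @commutator_compress setT B (~` B)
  clopenT cB cBc (@subsetT _ _) (@subsetT _ _) (ex_intro _ c (conj I Bc))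
  (ex_intro _ c Bc).
have : generated S [~ x, y] by apply: sub_generated; exists W, x, y.
by rewrite S1 => /= xy1; case: (xyB b Bb); rewrite xy1.
Qed.

Lemma small_generation H : is_subgroup H ->
  (forall W, clopen W -> W `<` setT -> rs W `<=` H) -> G `<=` H.
Proof.
move=> sH smallH; apply: comm_closedT_sub => // W x y cW WT rx ry.
by apply: subgroupR => //; apply: smallH WT _ _.
Qed.

(* Conjugating [s] by an element that fixes the part of [P] and [Ps] inside [W]
   pointwise shrinks the support of [s] without changing its action on [P]. *)
Lemma small_relocate W s P D : clopen W -> W `<` setT -> rs W s ->
  clopen P -> clopen D -> P `<=` D -> s @` P `<=` D ->
  D `\` (P `|` s @` P) !=set0 ->
  exists2 s', rs D s' & forall p, P p -> s' p = s p.
Proof.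
move=> cW [_ WT] rsW cP cD PD sPD D0.
have csP := clopen_image s cP.
pose V := (P `|` s @` P) `&` W.
have cV : clopen V by apply: clopenI => //; exact: clopenU.
have cD' : clopen (D `\` (P `|` s @` P)) by apply: clopenD => //; exact: clopenU.
have [h [Gh sh] hW] : exists2 h, rs (~` V) h &
    forall p, (W `\` V) p -> (D `\` (P `|` s @` P)) (h p).
  apply: vigorous_into => //; first exact: clopenC.
  - exact: clopenD.
  - by move=> p [_ nP] [].
  have [w Ww] : exists w, ~ W w.
    by apply: contrapT => /forallNP h; apply: WT => p _; apply: contrapT.
  by exists w; split; [case|case].
have hV p : V p -> h p = p by move=> Vp; apply: sh; exact.
have hV' p : V p -> h^-1 p = p by move=> Vp; rewrite -[in LHS](hV p Vp) homeoK.
have hWV p : W p -> (V `|` (D `\` (P `|` s @` P))) (h p).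
  move=> Wp; have [Vp|Vp] := pselect (V p); last by right; exact: hW.
  by left; rewrite hV.
have rs' : rs (h @` W) (s ^ h) by exact: rigid_stabJ.
exists (s ^ h).
  apply: rigid_stabS rs' => _ [p Wp <-]; case: (hWV p Wp) => [[+ _]|[]//].
  by case=> [/PD|/sPD].
move=> p Pp; have [Wp|Wp] := pselect (W p).
  have Vp : V p by split => //; left.
  have Vsp : V (s p).
    by split; [right; exists p|apply: supported_stable Wp; case: rsW].
  by rewrite conjgE !homeoM (hV' _ Vp) hV.
rewrite rs'.2; last first.
  by move=> [q Wq qp]; move: (hWV q Wq); rewrite qp => -[[]//|[_]]; apply; left.
by rewrite rsW.2.
Qed.

Definition locally_small g p := exists s W U, [/\ clopen W, W `<` setT, rs W s &
  [/\ clopen U, U p & forall q, U q -> s q = g q]].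

(** By [small_generation] it suffices that the elements with this local property form a subgroup.
    For a product, the two local factors are first relocated so that their supports jointly miss a
    point. *)
Lemma locally_smallP g p : G g -> locally_small g p.
Proof.
suff : G `<=` [set g | G g /\ forall p, locally_small g p] by move=> h /h [].
apply: small_generation; last first.
  move=> W cW WT s rW; split=> [|q]; first by case: rW.
  by exists s, W, setT; split => //; split=> //; exact: clopenT.
split=> [|x y [Gx lx] [Gy ly]|x [Gx lx]].
- split; first exact: subgroup1.
  move=> q; exists 1, set0, setT; split => //; first exact: clopen0.
  + by split=> // /(_ point I).
  + exact: subgroup1 (rigid_stab_subgroup _).
  + by split=> //; exact: clopenT.
- split=> [|{}p]; first exact: subgroupM.
  have [s [W [U [cW WT rW [cU Up sx]]]]] := lx p.
  have [t [Z [V [cZ ZT rZ [cV Vp ty]]]]] := ly (x p).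
  (* [R] avoids [p], [x p] and [y (x p)], and [P] is a neighbourhood of [p] that misses [R] together
     with its images under [x] and [x * y]. *)
  have [R1 [cR1 R10 _ R1p]] := @clopen_avoid setT p clopenT (ex_intro _ point I).
  have [R2 [cR2 R20 R21 R2p]] := @clopen_avoid R1 (x p) cR1 R10.
  have [R [cR R0 R12 Rp]] := @clopen_avoid R2 (y (x p)) cR2 R20.
  pose P := U `&` x @^-1` V `&` ((~` R) `&` x @^-1` (~` R) `&` (x * y)%g @^-1` (~` R)).
  have cRc : clopen (~` R) by exact: clopenC.
  have cP : clopen P.
    by do ![apply: clopenI|apply: clopen_preimage]; rewrite //; exact: clopen_preimage.
  have Pp : P p by split; [split|split; [split; [move=> /R12/R21|move=> /R12]|]].
  (* [R'] is the spare room for both relocations; [r], in [R] but not in [R'], stays outside the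
     supports of [s'] and [t']. *)
  have [R' [cR' R'0 R'R [r [Rr R'r]]]] := clopen_split cR R0.
  have sP : s @` P = x @` P.
    by apply/seteqP; split=> _ [q Pq <-]; exists q; rewrite ?sx//; case: Pq => -[].
  have tP : t @` (x @` P) = y @` (x @` P).
    apply/seteqP; split=> _ [_ [q Pq <-] <-]; exists (x q); rewrite ?ty//;
      by [case: Pq => -[]|exists q].
  have nR q : (P `|` x @` P `|` y @` (x @` P)) q -> ~ R q.
    by move=> [[[_ [[]]]|[? [_ [[_ +] _]] <-]]|[_ [? [_ [_ +]] <-] <-]].
  have cxP := clopen_image x cP.
  have cyP := clopen_image y cxP.
  have [r' R'r'] := R'0.
  have [s' rs' s'P] : exists2 s', rs (P `|` x @` P `|` R') s' & forall q, P q -> s' q = s q.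
    apply: (@small_relocate W) => //.
    + by do ![apply: clopenU => //].
    + by move=> q ?; left; left.
    + by rewrite sP => q ?; left; right.
    + rewrite sP; exists r'; split; first by right.
      by move=> h; apply: (nR r'); [left|exact: R'R].
  have [t' rt' t'P] : exists2 t', rs (x @` P `|` y @` (x @` P) `|` R') t' &
      forall q, (x @` P) q -> t' q = t q.
    apply: (@small_relocate Z) => //.
    + by do ![apply: clopenU => //].
    + by move=> q ?; left; left.
    + by rewrite tP => q ?; left; right.
    + rewrite tP; exists r'; split; first by right.
      by move=> h; apply: (nR r'); [case: h; [left; right|right]|exact: R'R].
  pose Y := P `|` x @` P `|` y @` (x @` P) `|` R'.
  exists (s' * t'), Y, P; split.
  + by do ![apply: clopenU => //].
  + by split=> // /(_ r I) []// /nR.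
  + apply: (subgroupM (rigid_stab_subgroup Y)).
      by apply: rigid_stabS rs' => q [?|?]; [left; left|right].
    by apply: rigid_stabS rt' => q [[?|?]|?]; [left; left; right|left; right|right].
  + split=> // q Pq; rewrite !homeoM s'P// t'P; last by rewrite sx; [exists q|case: Pq => -[]].
    by rewrite sx ?ty//; case: Pq => -[].
- split=> [|q]; first exact: subgroupV.
  have [s [W [U [cW WT rW [cU Up sx]]]]] := lx (x^-1 q).
  exists s^-1, W, (x @` U); split=> //; first by apply: subgroupV rW; exact: rigid_stab_subgroup.
  split; first exact: clopen_image.
    by apply/homeo_imageP.
  by move=> _ [u Uu <-]; rewrite homeoK -sx// homeoK.
Qed.

(** * Extending local pieces to elements of [G] *)

(** By compactness finitely many of the neighbourhoods cover [K]; what each one adds to the earlier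
    ones is clopen, so [K] is a finite disjoint union of sets satisfying [Q]. *)
Lemma clopen_disjoint_ind (Q : set CS -> Prop) K : clopen K -> Q set0 ->
  (forall U V, clopen U -> clopen V -> U `<=` K -> V `<=` K ->
     (forall p, U p -> ~ V p) -> Q U -> Q V -> Q (U `|` V)) ->
  (forall p, K p -> exists U, [/\ clopen U, U p &
     forall V, clopen V -> V `<=` U -> V `<=` K -> Q V]) -> Q K.
Proof.
move=> cK Q0 QU Qloc.
have /choice [f fP] : forall p, exists U, K p -> [/\ clopen U, U p &
     forall V, clopen V -> V `<=` U -> V `<=` K -> Q V].
  move=> p; have [/Qloc [U ?]|nK] := pselect (K p); first by exists U.
  by exists set0.
have : compact K by apply: (subclosed_compact _ cantor_space_compact) => //; case: cK.
rewrite compact_cover => /(_ _ K f) [p /fP[[]]//|p Kp|]; first by exists p => //; case: (fP p Kp).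
move=> D DK Kcov.
suff h (s : seq CS) : {subset s <= D} -> exists V, [/\ clopen V, V `<=` K, Q V &
    forall p q, q \in s -> K p -> f q p -> V p].
  have [V [cV VK QV Vs]] := h (enum_fset D) (fun _ => id).
  suff <- : V = K by [].
  by apply/seteqP; split=> // p Kp; case: (Kcov p Kp) => q /Vs; apply.
elim: s => [_|q s IH sD].
  by exists set0; split => //; exact: clopen0.
have /IH [V [cV VK QV Vs]] : {subset s <= D}.
  by move=> z zs; apply: sD; rewrite inE zs orbT.
have /DK : q \in D by apply: sD; rewrite inE eqxx.
move=> /set_mem /fP [cf fq Qf].
have cfV : clopen ((f q `&` K) `\` V) by apply: clopenD => //; exact: clopenI.
exists (V `|` (f q `&` K) `\` V); split.
- exact: clopenU.
- by move=> z [/VK//|[[]]].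
- apply: QU => //.
  + by move=> z [[]].
  + by move=> z ? [].
  + by apply: Qf => // z [[]].
move=> p z; rewrite inE => /predU1P[->|zs] Kp fzp; last by left; exact: Vs zs Kp fzp.
by have [|] := pselect (V p); [left|right].
Qed.

Definition locally_in f P := forall p, P p -> exists g U, [/\ G g, clopen U, U p &
  forall q, U q -> f q = g q].

(** The local pieces of [f] are relocated, with [Z] as spare room, and multiplied. As [P], its image
    and [Z] are disjoint, the factor for one piece of [P] moves no point of another piece or of its
    image. *)
Lemma extend_disjoint (f : HCS) P Z : clopen P -> clopen Z -> Z !=set0 ->
  (forall p, P p -> ~ P (f p)) -> (forall p, P p -> ~ Z p) ->
  (forall p, P p -> ~ Z (f p)) -> locally_in f P ->
  exists2 g, rs (P `|` f @` P `|` Z) g & forall p, P p -> g p = f p.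
Proof.
move=> cP cZ Z0 Pf PZ fPZ lf.
pose Q U := exists2 g, rs (U `|` f @` U `|` Z) g & forall p, U p -> g p = f p.
apply: (@clopen_disjoint_ind Q P) => //.
- exists 1 => //; exact: subgroup1 (rigid_stab_subgroup _).
- move=> U V cU cV UP VP UV [g rg gU] [h rh hV]; exists (g * h).
    apply: (subgroupM (rigid_stab_subgroup _)).
      apply: rigid_stabS rg => p [[?|[q ? <-]]|?]; [by left; left; left| |by right].
      by left; right; exists q => //; left.
    apply: rigid_stabS rh => p [[?|[q ? <-]]|?]; [by left; left; right| |by right].
    by left; right; exists q => //; right.
  move=> p [Up|Vp]; rewrite homeoM.
    rewrite gU// rh.2// => -[[Vfp|[q Vq /homeo_inj qp]]|].
    + by apply: (Pf p); [exact: UP|exact: VP].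
    + by apply: (UV p) => //; rewrite -qp.
    + by apply: fPZ; exact: UP.
  rewrite rg.2 ?hV// => -[[Up|[q Uq qp]]|].
  + exact: (UV p).
  + by apply: (Pf q); [exact: UP|rewrite qp; exact: VP].
  + by apply: PZ; exact: VP.
move=> p /[dup] Pp /lf [g [U [Gg cU Up gU]]].
have [s [W [V [cW WT rW [cV Vp sV]]]]] := @locally_smallP g p Gg.
exists (U `&` V); split=> //; first exact: clopenI.
move=> A cA AUV AP.
have fs q : A q -> f q = s q by move=> /AUV [Uq Vq]; rewrite gU// sV.
have fsA : f @` A = s @` A.
  by apply/seteqP; split=> _ [q Aq <-]; exists q; rewrite ?fs.
have [z Zz] := Z0.
have [g' rg' g'A] : exists2 g', rs (A `|` f @` A `|` Z) g' & forall p, A p -> g' p = s p.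
  apply: (@small_relocate W) => //.
  - by do ![apply: clopenU => //]; exact: clopen_image.
  - by move=> q ?; left; left.
  - by rewrite fsA => q ?; left; right.
  - exists z; split; [by right|rewrite -fsA => -[/AP/PZ//|[q /AP Pq qz]]].
    by apply: (fPZ q Pq); rewrite qz.
by exists g' => // q Aq; rewrite g'A ?fs.
Qed.

(** An element [c] of [G] first compresses [P] into a spare set [Z] that is disjoint from [P] and
    from its image under [f]. Then [c^-1 * f] moves the image of [P] under [c] off itself, and
    [extend_disjoint] applies. *)
Lemma extend_locally_in (f : HCS) P D : clopen P -> clopen D -> P `<=` D -> f @` P `<=` D ->
  D `\` (P `|` f @` P) !=set0 -> locally_in f P ->
  exists2 g, rs D g & forall p, P p -> g p = f p.
Proof.
move=> cP cD PD fPD D0 lf.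
have cfP := clopen_image f cP.
have cD' : clopen (D `\` (P `|` f @` P)) by apply: clopenD => //; exact: clopenU.
have [Z [cZ Z0 ZD D'0]] := clopen_split cD' D0.
set Z' := (X in X !=set0) in D'0.
have cZ' : clopen Z' by exact: clopenD.
have [c rc cPZ] : exists2 c, rs (P `|` Z) c & forall p, P p -> Z (c p).
  apply: vigorous_into => //; first exact: clopenU.
  move: Z0 => [z Zz]; exists z; split; first by right.
  by case: (ZD _ Zz) => _ h Pz; apply: h; left.
have ZP z : Z z -> ~ (f @` P) z.
  by move=> /ZD[_ h] fPz; apply: h; right.
have cfP' : (c^-1 * f)%g @` (c @` P) = f @` P.
  apply/seteqP; split=> z [q]; first by move=> [p Pp <-] <-; exists p => //; rewrite homeoM homeoK.
  by move=> Pq <-; exists (c q); [exists q|rewrite homeoM homeoK].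
have [g rg gP] : exists2 g, rs (c @` P `|` (c^-1 * f)%g @` (c @` P) `|` Z') g &
    forall p, (c @` P) p -> g p = (c^-1 * f) p.
  apply: extend_disjoint => //.
  - exact: clopen_image.
  - move=> _ [p Pp <-]; rewrite homeoM homeoK => -[q Pq qp].
    by apply: (ZP (c q)); [exact: cPZ|exists p].
  - by move=> _ [p Pp <-] []; move: (cPZ p Pp).
  - by move=> _ [p Pp <-] [[_ h] _]; apply: h; right; exists p => //; rewrite homeoM homeoK.
  - move=> _ [p Pp <-]; have [g [U [Gg cU Up gU]]] := lf p Pp.
    exists (c^-1 * g), (c @` U); split.
    + by apply: subgroupM => //; apply: subgroupV => //; case: rc.
    + exact: clopen_image.
    + by exists p.
    + by move=> _ [q Uq <-]; rewrite !homeoM homeoK gU.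
have ZD' z : Z z -> D z by move=> /ZD [].
exists (c * g).
  apply: (subgroupM (rigid_stab_subgroup D)); first by apply: rigid_stabS rc => p [/PD|/ZD'].
  apply: rigid_stabS rg; rewrite cfP' => p [[[q Pq <-]|/fPD//]|[[]]//].
  exact/ZD'/cPZ.
by move=> p Pp; rewrite homeoM gP; [rewrite homeoM homeoK|exists p].
Qed.

(* If [f] and [k] in [G] extend [t] and [h] from [A], with the error of [f]
   supported on a set fixed pointwise by [k], then the error cancels in
   [f^-1 * f ^ k]. *)
Lemma locally_in_mulJ (t h : HCS) A : clopen A -> supported t A ->
  locally_in t A -> locally_in h A -> (forall p, A p -> ~ A (h p)) ->
  (exists q, ~ (A `|` h @` A) q) -> G (t^-1 * t ^ h).
Proof.
move=> cA st lt lh Ah [q ABq].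
have chA := clopen_image h cA.
have cR : clopen (~` (A `|` h @` A)) by apply: clopenC => //; exact: clopenU.
(* The complement of [A] and its image is split: [D] absorbs the error of [f], and [D'] that of
   [k]. *)
have [D [cD D0 DR RD]] := clopen_split cR (ex_intro _ q ABq).
set D' := (X in X !=set0) in RD.
have cD' : clopen D' by exact: clopenD.
have tA : t @` A `<=` A by move=> _ [p Ap <-]; exact: supported_stable.
have [f [Gf sf] fA] : exists2 f, rs (A `|` D) f & forall p, A p -> f p = t p.
  apply: extend_locally_in => //.
  - exact: clopenU.
  - by move=> p /tA; left.
  - move: D0 => [d Dd]; exists d; split; first by right.
    by case=> [|/tA] Ad; apply: (DR _ Dd); left.
have [k [Gk sk] kA] : exists2 k, rs (A `|` h @` A `|` D') k & forall p, A p -> k p = h p.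
  apply: extend_locally_in => //.
  - by do ![apply: clopenU => //].
  - by move=> p ?; left; left.
  - by move=> p ?; left; right.
  - by move: RD => [d D'd]; exists d; split; [right|case: D'd].
suff -> : t^-1 * t ^ h = f^-1 * f ^ k by apply: subgroupM; [|exact: subgroupV|exact: subgroupJ].
rewrite (@conj_agree h k t A) //; last by move=> p /kA.
have {}kA p : A p -> (h @` A) (k p) by move=> Ap; rewrite kA//; exists p.
have kD p : D p -> k p = p.
  by move=> Dp; apply: sk => -[|[]//]; exact: DR.
have kD' p : D p -> k^-1 p = p by move=> Dp; rewrite -[in LHS](kD p Dp) homeoK.
have sfD p : ~ A p -> ~ D p -> f p = p by move=> ? ?; apply: sf => -[].
pose u := t^-1 * f.
have su : supported u D.
  move=> p Dp; rewrite homeoM; have [Ap|Ap] := pselect (A p).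
    rewrite fA ?homeoVK//; exact: supported_stable (supportedV st) Ap.
  by rewrite (supportedV st)// sfD.
have -> : f = t * u by rewrite mulgA mulgV mul1g.
have cuk : u ^ k = u.
  have : commute u k.
    apply: (@disjoint_supports_commute _ _ D (~` D)) => //.
    - by move=> p /contrapT; exact: kD.
    - by move=> p Dp; apply.
  by move=> ?; apply/eqP; rewrite conjg_fix; apply/commgP.
(* [D] lies off the supports of [t] and [t ^ k], so in the expanded product [u^-1] and [u] can be
   brought together and cancel. *)
have : commute u (t^-1 * t ^ k).
  apply: (@disjoint_supports_commute _ _ D (~` D)) => // [p /contrapT Dp|p ?]; last exact.
  rewrite homeoM conjgE !homeoM (supportedV st); last by move=> ?; apply: (DR _ Dp); left.
  rewrite kD' // st ?kD//; by move=> ?; apply: (DR _ Dp); left.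
move=> cu; rewrite conjMg cuk invgM -mulgA [t^-1 * (_ * u)]mulgA -[LHS](mulKg u).
by congr (_ * _); rewrite cu.
Qed.

End Vigorous.

(** * Labels *)

Section CyclePermutations.
Local Open Scope nat_scope.
Variable I : eqType.
Implicit Types (c : seq I) (x : I) (cs : seq (seq I)) (f : nat -> nat -> I).

Lemma next_notin c x : x \notin c -> next c x = x.
Proof. by rewrite next_nth => /negbTE ->. Qed.

Lemma next_mkseq (L : nat -> I) m k : uniq (mkseq L m) -> k < m ->
  next (mkseq L m) (L k) = L (k.+1 %% m).
Proof.
move=> um km; have Lk : nth (L 0) (mkseq L m) k = L k by rewrite nth_mkseq.
have ks : k < size (mkseq L m) by rewrite size_mkseq.
rewrite next_nth -Lk mem_nth// index_uniq//.
case: m {um Lk ks} km => // m; rewrite ltnS leq_eqVlt => /predU1P[->|km].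
  by rewrite modnn /= nth_default// size_map size_iota.
by rewrite modn_small//= (nth_map 0) ?size_iota// nth_iota// add1n.
Qed.

Lemma cycles_perm_notin cs x : x \notin flatten cs -> cycles_perm cs x = x.
Proof.
elim: cs => //= c cs IH; rewrite mem_cat negb_or => /andP[xc xcs].
by rewrite IH// next_notin.
Qed.

Lemma cycles_perm_next cs c x : uniq (flatten cs) -> c \in cs -> x \in c ->
  cycles_perm cs x = next c x.
Proof.
elim: cs => //= d cs IH; rewrite cat_uniq => /and3P[_ /hasPn dcs ucs].
have xcs' y b : b \in cs -> y \in b -> y \notin d.
  by move=> bcs yb; apply: dcs; apply/flattenP; exists b.
rewrite inE => /predU1P[->|ccs] xc.
  rewrite cycles_perm_notin//; apply/negP => /flattenP[b bcs xb].
  by move: xc; apply/negP; exact: xcs' bcs xb.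
by rewrite IH// next_notin//; apply: xcs' ccs _; rewrite mem_next.
Qed.

(** The common shape of the four lists of cycles: [i] selects a cycle, and position [k] on it is
    moved to [k + 1] modulo the length. *)
Definition family f (is_ : seq nat) m := [seq mkseq (f i) m | i <- is_].

Lemma mem_familyP f is_ m x :
  reflect (exists i k, [/\ i \in is_, k < m & x = f i k]) (x \in flatten (family f is_ m)).
Proof.
apply: (iffP flattenP) => [[_ /mapP[i ii ->] /mapP[k]]|[i [k [ii km ->]]]].
  by rewrite mem_iota => km ->; exists i, k.
exists (mkseq (f i) m); first exact: map_f.
by apply: map_f; rewrite mem_iota.
Qed.

Lemma cycles_perm_family f is_ m i k : uniq is_ ->
  (forall i j k l, i \in is_ -> j \in is_ -> k < m -> l < m ->
     f i k = f j l -> i = j /\ k = l) ->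
  i \in is_ -> k < m -> cycles_perm (family f is_ m) (f i k) = f i (k.+1 %% m).
Proof.
move=> ui finj ii km; have uf : uniq (flatten (family f is_ m)).
  apply: (@allpairs_uniq _ _ _ _ is_ (iota 0 m)) => //; first exact: iota_uniq.
  move=> [a b] [c d] /allpairsP[[? ?] /= [? + [-> ->]]] /allpairsP[[? ?] /= [? + [-> ->]]].
  by rewrite !mem_iota => ? ? /finj [] // -> ->.
have fm : mkseq (f i) m \in family f is_ m by apply: map_f.
rewrite (@cycles_perm_next _ (mkseq (f i) m))//; last by apply: map_f; rewrite mem_iota.
apply: next_mkseq => //.
rewrite map_inj_in_uniq ?iota_uniq// => a b; rewrite !mem_iota => ? ?.
by move=> /finj [].
Qed.

End CyclePermutations.

Section LabelCycles.
Local Open Scope nat_scope.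

(** The label at position [k] of the [i]-th cycle of [pi1]; positions 0 and 1 are irregular, and
    from 2 on the position is the last digit. *)
Definition cycle1_label i k :=
  match k with 0 => [:: 0; i] | 1 => [:: i; 0] | _ => [:: i; 0; k] end.

Definition cycle2_label i k :=
  match k with 0 => [:: i; 2] | 1 => [:: i; 1] | _ => [:: i; 1; k] end.

Lemma cycles1E m : 1 < m -> cycles1 m = family cycle1_label [:: 1; 2] m.
Proof.
case: m => [|[|m]] // _; rewrite /cycles1 /tail_labels /family /mkseq /= subn2 /=.
by congr [:: _ :: _ :: _; _ :: _ :: _]; apply/eq_in_map => -[|[|k]]; rewrite mem_iota.
Qed.

Lemma cycles2E m : 1 < m -> cycles2 m = family cycle2_label [:: 1; 2] m.
Proof.
case: m => [|[|m]] // _; rewrite /cycles2 /tail_labels /family /mkseq /= subn2 /=.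
by congr [:: _ :: _ :: _; _ :: _ :: _]; apply/eq_in_map => -[|[|k]]; rewrite mem_iota.
Qed.

Lemma cycles3E m : cycles3 m = family (fun i k => [:: 0; i; k]) [:: 0; 1] m.
Proof. by []. Qed.

Lemma cycles_betaE n : cycles_beta n = family (fun i k => [:: i; k]) (iota 0 3) n.
Proof. by []. Qed.

Lemma mem_labX m n x : x \in labX m n <->
  (exists i j k, [/\ 0 < i < 3, j < 2, 1 < k < m & x = [:: i; j; k]]) \/
  (exists i j, [/\ i < 3, j < n & x = [:: i; j]]).
Proof.
rewrite /labX mem_cat; split.
  move=> /orP[] /allpairsP[[a b] /= [+ + ->]]; last first.
    rewrite mem_iota !inE => /or3P[] /eqP -> bn; right;
      by [exists 0, b|exists 1, b|exists 2, b].
  rewrite mem_iota => aw bk; left.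
  have {}bk : 1 < b < m by lia.
  by move: aw; rewrite !inE => /or4P[] /eqP ->; rewrite /=;
    [exists 1, 0, b|exists 1, 1, b|exists 2, 0, b|exists 2, 1, b].
move=> [[i [j [k [i3 j2 /andP[k2 km] ->]]]]|[i [j [i3 jn ->]]]]; apply/orP; [left|right].
  apply/allpairsP; exists ([:: i; j], k); split=> //; last first.
    by rewrite mem_iota /=; lia.
  by move: i j i3 j2 => [|[|[|i]]] [|[|j]] ?? //=; rewrite !inE.
by apply/allpairsP; exists (i, j); split; rewrite ?mem_iota.
Qed.

Lemma mem_labY m y : y \in labY m <->
  exists i k, [/\ i < 2, k < m, y = [:: 0; i; k] & (i, k) != (0, 0)].
Proof.
rewrite /labY mem_filter; split.
  move=> /andP[y0 /allpairsP[[a b] /= [+ + ye]]]; subst y.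
  rewrite mem_iota !inE => aw bm; move: aw y0 => /orP[] /eqP -> y0;
    [exists 0, b|exists 1, b]; split=> //.
  by apply: contraNN y0 => /eqP[->].
move=> [i [k [i2 km -> ik]]]; apply/andP; split.
  by apply: contraNN ik => /eqP[-> ->].
apply/allpairsP; exists ([:: 0; i], k); split=> //; last by rewrite mem_iota.
by case: i i2 {ik} => [|[|]].
Qed.

End LabelCycles.

(** * Enacting elements, orbits and commutators *)

Section Enacting.
Implicit Types (U V : set CS) (x g : HCS) (p q : CS).

(** [D] may contain labels off the cycles: disjointness over all of [D] is what shows that their
    pieces are fixed. *)
Lemma enacts_cyclesE (I : eqType) U (gam : I -> HCS) cs x (D : {pred I}) :
  enacts_cycles U gam cs x -> {subset flatten cs <= D} ->
  (forall i j c d, i \in D -> j \in D -> U c -> U d -> gam i c = gam j d -> i = j) ->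
  forall i c, i \in D -> U c -> x (gam i c) = gam (cycles_perm cs i) c.
Proof.
move=> [xin xout] csD dis i c iD Uc; have [ics|ics] := boolP (i \in flatten cs).
  by rewrite (xin i ics) ?homeoM ?homeoK//; exists c.
rewrite cycles_perm_notin// xout// => j jcs [d Ud] /dis ji.
by move: ics; rewrite -(ji (csD _ jcs) iD Ud Uc) jcs.
Qed.

Lemma expgM_homeo g k l p : (g ^+ (k + l)) p = (g ^+ l) ((g ^+ k) p).
Proof. by rewrite expgnDr homeoM. Qed.

Lemma expgS_homeo g k p : (g ^+ k.+1) p = (g ^+ k) (g p).
Proof. by rewrite expgS homeoM. Qed.

Lemma expgSr_homeo g k p : (g ^+ k.+1) p = g ((g ^+ k) p).
Proof. by rewrite expgSr homeoM. Qed.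

Lemma expg_fix_dvd g k l p : (k %| l)%N -> (g ^+ k) p = p -> (g ^+ l) p = p.
Proof.
move=> /dvdnP[j ->] gp; elim: j => [|j IH]; first by rewrite mul0n expg0.
by rewrite mulSn expgM_homeo gp.
Qed.

Lemma expg_fix g k p : g p = p -> (g ^+ k) p = p.
Proof. by move=> gp; elim: k => [|k IH]; rewrite ?expg0 // expgS_homeo gp. Qed.

Lemma expg_fix_commute g k l p q : (g ^+ k) p = q -> (g ^+ l) p = p -> (g ^+ l) q = q.
Proof.
by move=> <- gp; rewrite -expgM_homeo addnC expgM_homeo gp.
Qed.

Lemma expg_cyclic (g : HCS) (P : nat -> CS) l k j : (j < l)%N ->
  (forall i, (i < l)%N -> g (P i) = P (i.+1 %% l)%N) -> (g ^+ k) (P j) = P ((j + k) %% l)%N.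
Proof.
move=> jl gP; elim: k => [|k IH]; first by rewrite expg0 addn0 modn_small.
by rewrite expgSr_homeo IH gP ?ltn_mod ?(leq_ltn_trans _ jl)// -addn1 modnDml addn1 addnS.
Qed.

(** Powers of [g] commute and are injective, so periods pass backwards along orbits;
    [expg_fix_commute] passes them forwards. *)
Lemma expg_fix_later (g : HCS) k l p q : (g ^+ k) p = q -> (g ^+ l) q = q -> (g ^+ l) p = p.
Proof.
by move=> <-; rewrite -expgM_homeo addnC expgM_homeo => /homeo_inj.
Qed.

(** Conjugation by [t * v] fixes [u] and acts on [s] as [t] does, so [u] and [v] drop out. *)
Lemma commg_factors (gT : groupType) (u s t v : gT) : commute u t -> commute u v ->
  commute v s -> commute v t -> [~ u * s, t * v] = [~ s, t].
Proof.
move=> ut uv vs vt; have fix_ (x y : gT) : commute x y -> x ^ y = x.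
  by move=> xy; apply/eqP; rewrite conjg_fix; apply/commgP.
rewrite !commgEl conjMg !conjgM (fix_ u t)// (fix_ u v)//.
rewrite (fix_ (s ^ t) v); last first.
  apply: commute_sym; rewrite conjgE; apply: commuteM; first exact: commuteV.
  exact: commuteM.
by rewrite invgM -mulgA mulKg.
Qed.

End Enacting.


(** * Involutions in vigorous simple groups *)

Section Involutions.
Variable G : set HCS.
Hypotheses (hG : is_subgroup G) (hvig : vigorous G).
Implicit Types (A B U V W K : set CS) (p q c d : CS) (g h w : HCS).
Local Notation rs := (rigid_stab G).

(* If [f] and [g] are supported on [U] and [k] moves [U] off itself, then
   [[~ f^-1, k]] is [f] times a factor commuting with [f] and [g], so its
   commutator with [g] is [[~ f, g]]. *)
Lemma comm_closed_of_conj (H : set HCS) C k : is_subgroup H -> clopen C -> rs C k ->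
  k <> 1 -> H k -> (forall w, rs C w -> exists2 h, H h & forall c, C c -> h c = w c) ->
  comm_closed G H C.
Proof.
move=> sH cC rk k1 Hk lift; have sC := rigid_stab_subgroup hG C.
(* An element of [H] that agrees with [w] on [C] conjugates [z] in the same way, so [w] itself need
   not be in [H]. *)
have conjH z w : rs C z -> H z -> rs C w -> H (z ^ w).
  move=> rz Hz /lift [h Hh hw].
  by rewrite -(@conj_agree h w z C) //; [exact: subgroupJ|exact: rz.2].
(* A point moved by [k] has a clopen neighbourhood [U] in [C] that [k] moves off itself. *)
have [p kp] : exists p, k p <> p.
  by apply: contrapT => /forallNP kp; apply: k1; apply: homeoP => p; exact: contrapT (kp p).
have Cp : C p by apply: contrapT => /rk.2.
have /eqP pk : p <> k p by move=> pk; apply: kp.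
have [V [cV Vp Vkp]] := cantor_zero_dimensional pk.
pose U := C `&` (V `&` k @^-1` (~` V)).
have cU : clopen U.
  by apply: clopenI => //; apply: clopenI => //; apply: clopen_preimage; exact: clopenC.
have UC : U `<=` C by move=> q [].
have Uk q : U q -> ~ (k @` U) q.
  by move=> [_ [Vq _]] [q' [_ [_ nV]] qq]; apply: nV; rewrite /= qq.
have commU f g : rs U f -> rs U g -> H [~ f, g].
  move=> rf rg; pose u := f^-1 ^ k; have su : supported u (k @` U).
    by apply: supportedJ; apply: supportedV; exact: rf.2.
  have uf : commute f u by exact: disjoint_supports_commute rf.2 su Uk.
  have ug : commute u g.
    by apply: commute_sym; exact: disjoint_supports_commute rg.2 su Uk.
  have zE : u * f = (k^-1) ^ f^-1 * k.
    by rewrite -uf /u !conjgE invgK !mulgA.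
  have [rfC rgC] : rs C f /\ rs C g by split; [exact: rigid_stabS rf|exact: rigid_stabS rg].
  have rkV : rs C k^-1 by exact: subgroupV.
  have Hz : H (u * f).
    rewrite zE; apply: subgroupM => //; apply: conjH => //; [exact: subgroupV|exact: subgroupV].
  have rz : rs C (u * f).
    by rewrite zE; apply: subgroupM => //; apply: subgroupJ => //; exact: subgroupV.
  rewrite -(@commg_factors _ u f g 1) // ?mulg1; try exact: commute1.
  - by rewrite commgEl; apply: subgroupM => //; [exact: subgroupV|exact: conjH].
  - by apply: commute_sym; exact: commute1.
  - by apply: commute_sym; exact: commute1.
move=> W x y cW WC rx ry; have [WC' nWC] := WC.
(* Vigour compresses [W] into [U], and conjugation by [w^-1] brings the commutator back. *)
have [w rw wW] : exists2 w, rs C w & forall q, W q -> U (w q).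
  apply: vigorous_into => //; last by exists p; split.
  apply: contrapT => /set0P/negP; rewrite negbK => /eqP CW0; apply: nWC => q Cq.
  by apply: contrapT => nWq; have : (C `\` W) q by []; rewrite CW0.
have sub z : rs W z -> rs U (z ^ w) by apply: rigid_stabJ_sub => //; exact: rw.1.
rewrite -[[~ x, y]](conjgK w) conjRg; apply: conjH.
- by apply: (subgroupR sC); [apply: rigid_stabS (sub _ rx)|apply: rigid_stabS (sub _ ry)].
- by apply: commU; exact: sub.
- exact: subgroupV.
Qed.

(** [R] is the graph of a map that is its own inverse, and continuity is local. Describing a
    piecewise map by a relation avoids choosing a label for each point beforehand. *)
Lemma involution_homeo (R : CS -> CS -> Prop) :
  (forall p, exists q, R p q) -> (forall p q q', R p q -> R p q' -> q = q') ->
  (forall p q, R p q -> R q p) ->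
  (forall p, exists g U, [/\ clopen U, U p & forall u, U u -> R u (g u)]) ->
  exists f : HCS, forall p, R p (f p).
Proof.
move=> /choice [f fR] Rfun Rsym Rloc.
have ff : cancel f f by move=> p; apply: (Rfun (f p)) => //; exact: Rsym.
have fc : continuous f.
  move=> p; have [g [U [cU Up gU]]] := Rloc p.
  have gf u : U u -> g u = f u by move=> Uu; apply: (Rfun u) => //; exact: gU.
  have nU : nbhs p U by apply: open_nbhs_nbhs; split=> //; case: cU.
  rewrite /continuous_at -(gf p Up); apply: cvg_trans (@homeo_fun_continuous _ g p).
  by apply: near_eq_cvg; apply: filterS nU => u; exact: gf.
by exists (Homeo ff ff fc fc).
Qed.

Lemma clopen_bigcup_seq (I : choiceType) (s : seq I) (F : I -> set CS) :
  (forall i, i \in s -> clopen (F i)) -> clopen (\bigcup_(i in [set` s]) F i).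
Proof.
move=> cF; rewrite bigcup_seq big_seq.
by apply: big_ind => //; [exact: clopen0|move=> ? ?; exact: clopenU].
Qed.

Hypothesis hsimple : is_simple G.

(** The map [t] flips labels on the [W] halves alone, with [K] choosing the flip, and [h] exchanges
    [gam x c] with [gam x (mu c)]. Both are locally in [G] on the [W] halves, so [locally_in_mulJ]
    puts [t^-1 * t ^ h] in [G]; this product flips labels on both halves. *)
Lemma paired_involution (I : choiceType) (gam : I -> HCS) (s : seq I) (W K : set CS)
    (mu : HCS) (flip : bool -> I -> I) :
  (forall x, x \in s -> G (gam x)) -> G mu -> clopen W -> clopen K ->
  (forall c, W c -> ~ W (mu c)) ->
  (forall x y c d, x \in s -> y \in s -> (W `|` mu @` W) c -> (W `|` mu @` W) d ->
     gam x c = gam y d -> x = y) ->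
  (forall b x, x \in s -> flip b x \in s /\ flip b (flip b x) = x) ->
  (exists q, forall x, x \in s -> ~ (gam x @` (W `|` mu @` W)) q) ->
  exists2 g, G g & (forall x c, x \in s -> W c ->
      g (gam x c) = gam (flip `[< K c >] x) c /\
      g (gam x (mu c)) = gam (flip `[< K c >] x) (mu c)) /\
    (forall p, (forall x, x \in s -> ~ (gam x @` (W `|` mu @` W)) p) -> g p = p).
Proof.
move=> Ggam Gmu cW cK Wmu dis flipP [q0 q0P].
have dis' x y c d : x \in s -> y \in s -> (W `|` mu @` W) c -> (W `|` mu @` W) d ->
    gam x c = gam y d -> x = y /\ c = d.
  move=> xs ys Wc Wd e; have xy := dis _ _ _ _ xs ys Wc Wd e; split=> //.
  by move: e; rewrite xy => /homeo_inj.
have WW c : W c -> (W `|` mu @` W) c by left.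
have WmuW c : W c -> (W `|` mu @` W) (mu c) by right; exists c.
pose A := \bigcup_(x in [set` s]) (gam x @` W).
pose B := \bigcup_(x in [set` s]) (gam x @` (mu @` W)).
have cA : clopen A by apply: clopen_bigcup_seq => x _; exact: clopen_image.
have cB : clopen B by apply: clopen_bigcup_seq => x _; do 2!apply: clopen_image.
have inA x c : x \in s -> W c -> A (gam x c) by move=> xs Wc; exists x => //; exists c.
have inB x c : x \in s -> W c -> B (gam x (mu c)).
  by move=> xs Wc; exists x => //; exists (mu c) => //; exists c.
have AB p : A p -> ~ B p.
  move=> [x xs [c Wc <-]] [y ys [_ [d Wd <-] e]].
  have [_ cd] := dis' _ _ _ _ ys xs (WmuW d Wd) (WW c Wc) e.
  by apply: (Wmu d Wd); rewrite cd.
pose Rt p q := (exists x c, [/\ x \in s, W c, p = gam x c & q = gam (flip `[< K c >] x) c])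
  \/ (~ A p /\ q = p).
(* The choice of flip is constant on each clopen part [V b], so that [t] is given there by
   [(gam x)^-1 * gam y] for a single label [y]. *)
pose V b := [set d | W d /\ `[< K d >] = b].
have cV b : clopen (V b).
  case: b.
    have -> : V true = W `&` K by apply/seteqP; split=> d [Wd] /asboolP.
    exact: clopenI.
  have -> : V false = W `\` K.
    by apply/seteqP; split=> d [Wd] Kd; split=> //; apply/asboolPn; rewrite ?Kd//; apply/negbT.
  exact: clopenD.
have [t tR] : exists t : HCS, forall p, Rt p (t p).
  apply: involution_homeo.
  - move=> p; have [[x xs [c Wc <-]]|nA] := pselect (A p); last by exists p; right.
    by exists (gam (flip `[< K c >] x) c); left; exists x, c.
  - move=> p q q' [[x [c [xs Wc -> ->]]]|[nA ->]] [[y [d [ys Wd e ->]]]|[nA' ->]] //.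
    + by have [-> ->] := dis' _ _ _ _ xs ys (WW c Wc) (WW d Wd) e.
    + by case: nA'; exact: inA.
    + by case: nA; rewrite e; exact: inA.
  - move=> p q [[x [c [xs Wc -> ->]]]|[nA ->]]; last by right.
    have [fs ffx] := flipP `[< K c >] x xs.
    by left; exists (flip `[< K c >] x), c; rewrite ffx.
  - move=> p; have [[x xs [c Wc <-]]|nA] := pselect (A p); last first.
      by exists 1, (~` A); split=> //; [exact: clopenC|by move=> u; right].
    exists ((gam x)^-1 * gam (flip `[< K c >] x)), (gam x @` V `[< K c >]); split.
    + exact: clopen_image.
    + by exists c.
    + move=> _ [d [Wd dc] <-]; left; exists x, d.
      by rewrite homeoM homeoK dc.
pose Rh p q := (exists x c, [/\ x \in s, W c & (p = gam x c /\ q = gam x (mu c)) \/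
  (p = gam x (mu c) /\ q = gam x c)]) \/ [/\ ~ A p, ~ B p & q = p].
have [h hR] : exists h : HCS, forall p, Rh p (h p).
  apply: involution_homeo.
  - move=> p; have [[x xs [c Wc <-]]|nA] := pselect (A p).
      by exists (gam x (mu c)); left; exists x, c; split=> //; left.
    have [[x xs [_ [c Wc <-] <-]]|nB] := pselect (B p).
      by exists (gam x c); left; exists x, c; split=> //; right.
    by exists p; right.
  - move=> p q q' [[x [c [xs Wc [] [-> ->]]]]|[nA nB ->]]
        [[y [d [ys Wd [] [e ->]]]]|[nA' nB' ->]] //.
    + by have [-> ->] := dis' _ _ _ _ xs ys (WW c Wc) (WW d Wd) e.
    + by case: (AB (gam x c)); [exact: inA|rewrite e; exact: inB].
    + by case: nA'; exact: inA.
    + by case: (AB (gam y d)); [exact: inA|rewrite -e; exact: inB].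
    + by have [-> /homeo_inj ->] := dis' _ _ _ _ xs ys (WmuW c Wc) (WmuW d Wd) e.
    + by case: nB'; exact: inB.
    + by case: nA; rewrite e; exact: inA.
    + by case: nB; rewrite e; exact: inB.
  - move=> p q [[x [c [xs Wc [] [-> ->]]]]|[nA nB ->]]; last by right.
      by left; exists x, c; split=> //; right.
    by left; exists x, c; split=> //; left.
  - move=> p; have [[x xs [c Wc <-]]|nA] := pselect (A p).
      exists (mu ^ gam x), (gam x @` W); split; [exact: clopen_image|by exists c|].
      move=> _ [d Wd <-]; left; exists x, d; split=> //; left.
      by rewrite conjgE !homeoM homeoK.
    have [[x xs [_ [c Wc <-] <-]]|nB] := pselect (B p).
      exists (mu^-1 ^ gam x), (gam x @` (mu @` W)); split.
      + by do 2!apply: clopen_image.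
      + by exists (mu c) => //; exists c.
      + move=> _ [_ [d Wd <-] <-]; left; exists x, d; split=> //; right.
        by rewrite conjgE !homeoM !homeoK.
    exists 1, (~` A `&` ~` B); split=> //; first by apply: clopenI; exact: clopenC.
    by move=> u [? ?]; right.
have tA x c : x \in s -> W c -> t (gam x c) = gam (flip `[< K c >] x) c.
  move=> xs Wc; case: (tR (gam x c)) => [[y [d [ys Wd e ->]]]|[]]; last by case; exact: inA.
  by have [-> ->] := dis' _ _ _ _ xs ys (WW c Wc) (WW d Wd) e.
have st : supported t A.
  by move=> p nA; case: (tR p) => [[y [d [ys Wd e _]]]|[_ ->]] //; case: nA; rewrite e; exact: inA.
have tt p : t (t p) = p.
  have [[x xs [c Wc <-]]|nA] := pselect (A p); last by rewrite !st.
  by have [fs ff] := flipP `[< K c >] x xs; rewrite !tA// ff.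
have tV : t^-1 = t by apply: homeoP => p; apply: (homeo_inj (g := t)); rewrite homeoVK tt.
have hA x c : x \in s -> W c -> h (gam x c) = gam x (mu c).
  move=> xs Wc; case: (hR (gam x c)) => [[y [d [ys Wd [] [e ->]]]]|[]].
  + by have [-> ->] := dis' _ _ _ _ xs ys (WW c Wc) (WW d Wd) e.
  + by case: (AB (gam x c)); [exact: inA|rewrite e; exact: inB].
  + by case; exact: inA.
have hB x c : x \in s -> W c -> h^-1 (gam x (mu c)) = gam x c.
  by move=> xs Wc; rewrite -hA// homeoK.
have hA' x c : x \in s -> W c -> h^-1 (gam x c) = gam x (mu c).
  move=> xs Wc; apply: (homeo_inj (g := h)); rewrite homeoVK.
  case: (hR (gam x (mu c))) => [[y [d [ys Wd [] [e ->]]]]|[_]].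
  + by case: (AB (gam y d)); [exact: inA|rewrite -e; exact: inB].
  + by have [-> /homeo_inj ->] := dis' _ _ _ _ xs ys (WmuW c Wc) (WmuW d Wd) e.
  + by case; exact: inB.
(* [h^-1] carries the [W] halves to the other halves, which [t] fixes. *)
have th x c : x \in s -> W c -> (t ^ h) (gam x c) = gam x c.
  move=> xs Wc; rewrite conjgE !homeoM hA'// st ?hA'//.
    by rewrite -hA'// homeoVK.
  by move=> /AB; apply; exact: inB.
exists (t^-1 * t ^ h).
  apply: (locally_in_mulJ hG hvig hsimple cA) => //.
  - move=> _ [x xs [c Wc <-]].
    have [fs _] := flipP `[< K c >] x xs.
    exists ((gam x)^-1 * gam (flip `[< K c >] x)), (gam x @` V `[< K c >]); split.
    + by apply: (subgroupM hG); [apply: (subgroupV hG)|]; exact: Ggam.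
    + exact: clopen_image.
    + by exists c.
    + by move=> _ [d [Wd dc] <-]; rewrite homeoM homeoK tA// dc.
  - move=> _ [x xs [c Wc <-]]; exists (mu ^ gam x), (gam x @` W); split.
    + by apply: (subgroupJ hG) => //; exact: Ggam.
    + exact: clopen_image.
    + by exists c.
    + by move=> _ [d Wd <-]; rewrite hA// conjgE !homeoM homeoK.
  - by move=> _ [x xs [c Wc <-]] /AB; apply; rewrite hA//; exact: inB.
  - exists q0 => -[[x xs [c Wc e]]|[_ [x xs [c Wc <-]] e]].
      by apply: (q0P x xs); exists c => //; left.
    by apply: (q0P x xs); exists (mu c); [exact: WmuW|rewrite -e hA].
rewrite tV; split=> [x c xs Wc|p pP].
  have [fs _] := flipP `[< K c >] x xs.
  split; rewrite homeoM; first by rewrite tA// th.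
  rewrite (st (gam x (mu c))); last by move=> /AB; apply; exact: inB.
  by rewrite conjgE !homeoM hB// tA// hA.
have [nA nB] : ~ A p /\ ~ B p.
  split=> [[x xs [c Wc e]]|[x xs [d [c Wc cd] e]]]; apply: (pP x xs).
    by exists c => //; left.
  by exists d => //; right; exists c.
have hp : h p = p.
  case: (hR p) => [[x [c [xs Wc [] [e _]]]]|[]//].
    by case: nA; rewrite e; exact: inA.
  by case: nB; rewrite e; exact: inB.
have hVp : h^-1 p = p by rewrite -[in LHS]hp homeoK.
by rewrite homeoM (st p)// conjgE !homeoM hVp (st p)// hp.
Qed.

End Involutions.

(** * Small cardinalities and the halves of an even set *)

Lemma card_set2 (T : Type) (a b : T) : a <> b -> ([set a; b] #= `I_2)%card.
Proof.
move=> ab; apply/eq_cardSP; exists a; first by left.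
have -> : [set a; b] `\ a = [set b]; last exact: card_set1.
by apply/seteqP; split=> [x [[]]|x ->] //; split; [right|apply: nesym].
Qed.

Lemma card_set3 (T : Type) (a b c : T) : a <> b -> a <> c -> b <> c ->
  ([set a; b; c] #= `I_3)%card.
Proof.
move=> ab ac bc; apply/eq_cardSP; exists c; first by right.
have -> : [set a; b; c] `\ c = [set a; b]; last exact: card_set2.
by apply/seteqP; split=> [x [[]]|x [] ->] //; split; [left; left| |left; right|].
Qed.

Lemma properset_missing (T : Type) (A B : set T) : A `<` B -> exists2 x, B x & ~ A x.
Proof.
move=> [_ nBA]; apply: contrapT => /forall2NP h; apply: nBA => x Bx.
by case: (h x) => // /contrapT.
Qed.

(** Evenness writes [C] as the image under some [g] of the disjoint union of the images of [W] under
    [mu] and [nu]. The halves are the images of [W] under [mu * g] and [nu * g]. *)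
Lemma even_halves (G : set HCS) (C : set CS) : is_subgroup G -> even_class G C ->
  exists W mu, [/\ clopen W, G mu, forall c, W c -> ~ W (mu c) & C = W `|` mu @` W].
Proof.
move=> hG [W [cW _ _] [mu [nu [Gmu Gnu dis _ cls]]]].
have [g Gg CE] : clopen_class G ((mu @` W) `|` (nu @` W)) C.
  by rewrite -cls; exists 1; [exact: subgroup1|rewrite image_id].
exists ((mu * g)%g @` W), ((mu * g)^-1 * (nu * g)); split.
- exact: clopen_image.
- by apply: subgroupM; [|apply: subgroupV => //|]; do ?apply: subgroupM.
- move=> _ [w Ww <-] /homeo_imageP; rewrite (homeoM (mu * g)^-1) homeoK => Wm.
  have : ((mu @` W) `&` (nu @` W)) (nu w).
    split; last by exists w.
    apply/homeo_imageP; suff -> : mu^-1 (nu w) = (mu * g)^-1 ((nu * g) w) by [].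
    by apply: (homeo_inj (g := mu * g)); rewrite homeoVK !homeoM homeoVK.
  by rewrite dis.
rewrite CE; apply/seteqP; split=> p.
  move=> [q [[w Ww <-]|[w Ww <-]] <-]; first by left; exists w.
  right; exists ((mu * g) w); first by exists w.
  by rewrite (homeoM (mu * g)^-1) homeoK.
move=> [[w Ww <-]|[_ [w Ww <-] <-]]; first by exists (mu w) => //; left; exists w.
by exists (nu w); [right; exists w|rewrite (homeoM (mu * g)^-1) homeoK].
Qed.

(** * The pair Phi *)

Section Phi.
Variables (m n : nat) (hm : (2 <= m)%N) (hn : (3 <= n)%N).
Variables (G : set HCS) (hG : is_subgroup G) (C E : set CS) (sigma tau : HCS)
  (gam : seq nat -> HCS).
Hypotheses (Gsigma : G sigma) (Gtau : G tau).
Hypotheses (sup_sigma : supported sigma C) (sup_tau : supported tau C).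
Hypothesis hch : Phi_choice m n G C sigma tau gam E.
Variables (pi1 pi2 pi3 alpha beta : HCS).
Hypotheses (Gpi1 : G pi1) (Gpi2 : G pi2) (Gpi3 : G pi3) (Gbeta : G beta).
Hypotheses (enact1 : enacts_cycles C gam (cycles1 m) pi1)
  (enact2 : enacts_cycles C gam (cycles2 m) pi2)
  (enact3 : enacts_cycles E gam (cycles3 m) pi3)
  (enactb : enacts_cycles C gam (cycles_beta n) beta).
Hypothesis alphaE : alpha = (tau^-1) ^ gam [:: 1; 1]%N * tau ^ gam [:: 1; 2]%N
  * (sigma^-1) ^ gam [:: 2; 1]%N * sigma ^ gam [:: 2; 2]%N * pi1 * pi2 * pi3.

Implicit Types (p c d e : CS) (x y : seq nat) (i j k : nat).

Local Notation X := (labX m n).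
Local Notation L1 := cycle1_label.
Local Notation L2 := cycle2_label.

(** * The pieces of the space and their labels *)

Lemma row_labX i j : (i < 3)%N -> (j < n)%N -> [:: i; j] \in X.
Proof. by move=> i3 jn; apply/mem_labX; right; exists i, j. Qed.

Lemma labX00 : [:: 0; 0]%N \in X. Proof. by apply: row_labX => //; lia. Qed.

Lemma cycle1_labX i k : (0 < i < 3)%N -> (k < m)%N -> L1 i k \in X.
Proof.
move=> i3 km; apply/mem_labX; case: k km => [|[|k]] km.
- by right; exists 0%N, i; split=> //; lia.
- by right; exists i, 0%N; split=> //; lia.
- by left; exists i, 0%N, k.+2.
Qed.

Lemma cycle2_labX i k : (0 < i < 3)%N -> (k < m)%N -> L2 i k \in X.
Proof.
move=> i3 km; apply/mem_labX; case: k km => [|[|k]] km.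
- by right; exists i, 2%N; split=> //; lia.
- by right; exists i, 1%N; split=> //; lia.
- by left; exists i, 1%N, k.+2.
Qed.

Lemma mem_12 i : (i \in [:: 1; 2]%N) = (0 < i < 3)%N.
Proof. by case: i => [|[|[|i]]]. Qed.

Lemma mem_01 i : (i \in [:: 0; 1]%N) = (i < 2)%N.
Proof. by case: i => [|[|i]]. Qed.

Lemma label_disjoint x y c d : x \in X -> y \in X -> C c -> C d ->
  gam x c = gam y d -> x = y.
Proof.
move=> xX yX Cc Cd e; apply: (Phi_disjX hch) => //; exists (gam x c); split; first by exists c.
by rewrite e; exists d.
Qed.

Lemma label_notE x c : x \in X -> C c -> ~ E (gam x c).
Proof.
move=> xX Cc Ex; have := Phi_disjXE hch; rewrite -subset0 => /(_ (gam x c)); apply.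
by split=> //; exists x => //; exists c.
Qed.

Lemma label_cover p : E p \/ exists x c, [/\ x \in X, C c & p = gam x c].
Proof.
have : setT p by []; rewrite -(Phi_cover hch) => -[[x xX [c Cc <-]]|Ep]; [right|by left].
by exists x, c.
Qed.

Lemma gam00 : gam [:: 0; 0]%N = 1. Proof. exact: Phi_gam00 hch. Qed.
Lemma gam000 : gam [:: 0; 0; 0]%N = 1. Proof. exact: Phi_gam000 hch. Qed.

Lemma labY_sub y e : y \in labY m -> E e -> C (gam y e).
Proof.
by move=> yY Ee; apply: (proj1 (Phi_subY hch (t := gam y e) _)); exists y => //; exists e.
Qed.

Lemma labY_fixed y e : y \in labY m -> E e -> (sigma * tau) (gam y e) = gam y e.
Proof.
move=> yY Ee; apply: contrapT.
by apply: (proj2 (Phi_subY hch (t := gam y e) _)); exists y => //; exists e.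
Qed.

Lemma labY_mem i k : (i < 2)%N -> (k < m)%N -> (0 < i + k)%N -> [:: 0; i; k] \in labY m.
Proof.
move=> i2 km ik; apply/mem_labY; exists i, k; split=> //.
by apply: contraTneq ik => -[-> ->].
Qed.

Lemma C_notE c : C c -> ~ E c.
Proof. by move=> Cc; have := @label_notE [:: 0; 0]%N c labX00 Cc; rewrite gam00. Qed.

(** Label [000] stands for [E] itself, outside [C], while all other copies of [E] lie in [C]. *)
Lemma E_cases i k e : (i < 2)%N -> (k < m)%N -> E e ->
  ((i, k) = (0, 0)%N /\ gam [:: 0; i; k] e = e) \/
  ([:: 0; i; k] \in labY m /\ C (gam [:: 0; i; k] e)).
Proof.
move=> i2 km Ee; case: (posnP (i + k)) => [|ik].
  by move=> /eqP; rewrite addn_eq0 => /andP[/eqP -> /eqP ->]; left; rewrite gam000.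
by have h := labY_mem i2 km ik; right; split=> //; exact: labY_sub.
Qed.

Lemma mem_cycles3 y : y \in flatten (cycles3 m) ->
  exists i k, [/\ (i < 2)%N, (k < m)%N & y = [:: 0; i; k]%N].
Proof.
rewrite cycles3E => /mem_familyP[i [k [+ km ->]]]; rewrite mem_01 => i2.
by exists i, k.
Qed.

Lemma labE_disjoint i k j l e e' : (i < 2)%N -> (k < m)%N -> (j < 2)%N -> (l < m)%N ->
  E e -> E e' -> gam [:: 0; i; k]%N e = gam [:: 0; j; l]%N e' -> [:: 0; i; k]%N = [:: 0; j; l]%N.
Proof.
move=> i2 km j2 lm Ee Ee' ee'.
case: (E_cases i2 km Ee); case: (E_cases j2 lm Ee').
- by move=> [[-> ->] _] [[-> ->] _].
- by move=> [_ +] [_ eE]; rewrite -ee' eE => /C_notE.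
- by move=> [_ eE] [_ +]; rewrite ee' eE => /C_notE.
move=> [lY _] [kY _]; apply: (Phi_disjY hch) => //.
exists (gam [:: 0; i; k]%N e); split; first by exists e.
by rewrite ee'; exists e'.
Qed.

(** * Action of the enacting elements on the pieces *)

Lemma pi3E i k e : (i < 2)%N -> (k < m)%N -> E e ->
  pi3 (gam [:: 0; i; k]%N e) = gam [:: 0; i; k.+1 %% m]%N e.
Proof.
move=> i2 km Ee; have := enact3; rewrite cycles3E => en.
rewrite (enacts_cyclesE (D := [pred x | x \in flatten (cycles3 m)]) en)//; last first.
- by rewrite inE cycles3E; apply/mem_familyP; exists i, k; rewrite mem_01.
- move=> x y c d /mem_cycles3[a [b [a2 bm ->]]] /mem_cycles3[a' [b' [a'2 b'm ->]]].
  exact: labE_disjoint.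
rewrite (cycles_perm_family (f := fun i k => [:: 0; i; k]%N)) ?mem_01//.
by move=> ? ? ? ? _ _ _ _ [-> ->].
Qed.

Lemma pi3_fix p : ~ E p -> (forall y, y \in labY m -> ~ (gam y @` E) p) -> pi3 p = p.
Proof.
move=> nE nY; apply: enact3.2 => y /mem_cycles3[i [k [i2 km ->]]] [e Ee ep].
case: (E_cases i2 km Ee) => [[_ eE]|[/nY + _]].
  by apply: nE; rewrite -ep eE.
by apply; exists e.
Qed.

Lemma pi3_label x c : x \in X -> x <> [:: 0; 0]%N -> C c -> pi3 (gam x c) = gam x c.
Proof.
move=> xX x00 Cc; apply: pi3_fix; first exact: label_notE.
move=> y yY [e Ee ec]; apply: x00; apply: (@label_disjoint _ _ c (gam y e)) => //.
- exact: labX00.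
- exact: labY_sub.
- by rewrite gam00 ec.
Qed.

Lemma enacts_fixE cs g e : enacts_cycles C gam cs g -> {subset flatten cs <= X} -> E e ->
  g e = e.
Proof.
move=> en csX Ee; apply: en.2 => y /csX yX [c Cc ce].
by apply: (@label_notE y c) => //; rewrite ce.
Qed.

Lemma cycles1_labX : {subset flatten (cycles1 m) <= X}.
Proof.
move=> x; rewrite cycles1E// => /mem_familyP[i [k [+ km ->]]]; rewrite mem_12 => i3.
exact: cycle1_labX.
Qed.

Lemma cycles2_labX : {subset flatten (cycles2 m) <= X}.
Proof.
move=> x; rewrite cycles2E// => /mem_familyP[i [k [+ km ->]]]; rewrite mem_12 => i3.
exact: cycle2_labX.
Qed.

Lemma cycles_beta_labX : {subset flatten (cycles_beta n) <= X}.
Proof.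
move=> x; rewrite cycles_betaE => /mem_familyP[i [k [+ kn ->]]]; rewrite mem_iota => i3.
exact: row_labX.
Qed.

Lemma pi1_label x c : x \in X -> C c -> pi1 (gam x c) = gam (cycles_perm (cycles1 m) x) c.
Proof.
by apply: (enacts_cyclesE (D := [pred x | x \in X]) enact1 cycles1_labX); exact: label_disjoint.
Qed.

Lemma pi2_label x c : x \in X -> C c -> pi2 (gam x c) = gam (cycles_perm (cycles2 m) x) c.
Proof.
by apply: (enacts_cyclesE (D := [pred x | x \in X]) enact2 cycles2_labX); exact: label_disjoint.
Qed.

Lemma beta_label x c : x \in X -> C c -> beta (gam x c) = gam (cycles_perm (cycles_beta n) x) c.
Proof.
by apply: (enacts_cyclesE (D := [pred x | x \in X]) enactb cycles_beta_labX); exact: label_disjoint.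
Qed.

Lemma cycles_perm1 i k : (0 < i < 3)%N -> (k < m)%N ->
  cycles_perm (cycles1 m) (L1 i k) = L1 i (k.+1 %% m).
Proof.
move=> i3 km; rewrite cycles1E// cycles_perm_family ?mem_12// => a b k' l.
by rewrite !mem_12 => a3 b3 _ _; case: k' l => [|[|k']] [|[|l]] //= -[]; lia.
Qed.

Lemma cycles_perm2 i k : (0 < i < 3)%N -> (k < m)%N ->
  cycles_perm (cycles2 m) (L2 i k) = L2 i (k.+1 %% m).
Proof.
move=> i3 km; rewrite cycles2E// cycles_perm_family ?mem_12// => a b k' l.
by rewrite !mem_12 => a3 b3 _ _; case: k' l => [|[|k']] [|[|l]] //= -[]; lia.
Qed.

Lemma cycles_perm1_notin x : (forall i k, (0 < i < 3)%N -> x <> L1 i k) ->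
  cycles_perm (cycles1 m) x = x.
Proof.
move=> xL; rewrite cycles1E// cycles_perm_notin//; apply/mem_familyP => -[i [k [+ km xe]]].
by rewrite mem_12 => /xL /(_ xe).
Qed.

Lemma cycles_perm2_notin x : (forall i k, (0 < i < 3)%N -> x <> L2 i k) ->
  cycles_perm (cycles2 m) x = x.
Proof.
move=> xL; rewrite cycles2E// cycles_perm_notin//; apply/mem_familyP => -[i [k [+ km xe]]].
by rewrite mem_12 => /xL /(_ xe).
Qed.

Lemma beta_row i j c : (i < 3)%N -> (j < n)%N -> C c ->
  beta (gam [:: i; j] c) = gam [:: i; (j.+1 %% n)%N] c.
Proof.
move=> i3 jn Cc; rewrite beta_label ?row_labX// cycles_betaE.
rewrite (cycles_perm_family (f := fun i k => [:: i; k]%N)) ?mem_iota//.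
by move=> ? ? ? ? _ _ _ _ [-> ->].
Qed.

Lemma beta_tail i j k c : [:: i; j; k] \in X -> C c ->
  beta (gam [:: i; j; k] c) = gam [:: i; j; k] c.
Proof.
move=> xX Cc; rewrite beta_label// cycles_perm_notin// cycles_betaE.
by apply/mem_familyP => -[? [? []]].
Qed.

Lemma beta_E e : E e -> beta e = e.
Proof. exact: enacts_fixE enactb cycles_beta_labX. Qed.

(** * Action of [alpha] on the pieces *)

(** The conjugates of [sigma], [tau] and their inverses in [alpha] preserve every piece; this is
    their action in the coordinate of [C], with one factor for each special label. *)
Definition twist x (c : CS) : CS :=
  if x == [:: 2; 2]%N then sigma c else if x == [:: 2; 1]%N then (sigma^-1) c
  else if x == [:: 1; 2]%N then tau c else if x == [:: 1; 1]%N then (tau^-1) c else c.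

Lemma twistC x c : C c -> C (twist x c).
Proof.
move=> Cc; rewrite /twist.
by do ![case: ifP => _]; do ?[apply: supported_stable => //; apply: supportedV => //].
Qed.

Lemma conj_label (s : HCS) z x c : supported s C -> z \in X -> x \in X -> C c ->
  (s ^ gam z) (gam x c) = gam x (if x == z then s c else c).
Proof.
move=> ss zX xX Cc; case: eqP => [->|xz]; first by rewrite conjgE !homeoM homeoK.
apply: (supportedJ (U := C) ss) => -[d Cd dc].
by apply: xz; apply: (@label_disjoint x z c d).
Qed.

Lemma conj_E (s : HCS) z e : supported s C -> z \in X -> E e -> (s ^ gam z) e = e.
Proof.
move=> ss zX Ee; apply: (supportedJ (U := C) ss) => -[d Cd dc].
by apply: (@label_notE z d) => //; rewrite dc.
Qed.

Lemma labX11 : [:: 1; 1]%N \in X. Proof. by apply: row_labX => //; lia. Qed.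
Lemma labX12 : [:: 1; 2]%N \in X. Proof. by apply: row_labX => //; lia. Qed.
Lemma labX21 : [:: 2; 1]%N \in X. Proof. by apply: row_labX => //; lia. Qed.
Lemma labX22 : [:: 2; 2]%N \in X. Proof. by apply: row_labX => //; lia. Qed.

Lemma twistE x c : x \in X -> C c ->
  ((tau^-1) ^ gam [:: 1; 1]%N * tau ^ gam [:: 1; 2]%N
   * (sigma^-1) ^ gam [:: 2; 1]%N * sigma ^ gam [:: 2; 2]%N) (gam x c) = gam x (twist x c).
Proof.
move=> xX Cc; have svV := supportedV sup_sigma; have stV := supportedV sup_tau.
rewrite (homeoM (_ * _ * _)) (homeoM (_ * _)) (homeoM (_ ^ _)) conj_label ?labX11//.
rewrite conj_label ?labX12//; last by case: eqP => // _; exact: supported_stable.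
rewrite conj_label ?labX21//; last first.
  by do 2![case: eqP => _]; do ?[apply: supported_stable => //].
rewrite conj_label ?labX22//; last first.
  by do 3![case: eqP => _]; do ?[apply: supported_stable => //].
congr (gam x _); rewrite /twist.
case: (eqVneq x [:: 2; 2]%N) => [->//|_]; case: (eqVneq x [:: 2; 1]%N) => [->//|_].
by case: (eqVneq x [:: 1; 2]%N) => [->//|_].
Qed.

Lemma alpha_label x c : x \in X -> C c -> cycles_perm (cycles1 m) x \in X ->
  alpha (gam x c) =
  pi3 (gam (cycles_perm (cycles2 m) (cycles_perm (cycles1 m) x)) (twist x c)).
Proof.
move=> xX Cc x'X; rewrite alphaE homeoM homeoM homeoM twistE//.
by rewrite pi1_label ?pi2_label//; exact: twistC.
Qed.

(** These cycles avoid [00], the labels of [pi2] and the twisted labels, so only [pi1] acts. *)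
Lemma alpha_cycle1 i k c : (0 < i < 3)%N -> (k < m)%N -> C c ->
  alpha (gam (L1 i k) c) = gam (L1 i (k.+1 %% m)) c.
Proof.
move=> i3 km Cc; have k'm : (k.+1 %% m < m)%N by rewrite ltn_mod; lia.
have LX := cycle1_labX i3 k'm; have LX' := cycle1_labX i3 km.
rewrite alpha_label ?cycles_perm1// cycles_perm2_notin; last first.
  by move=> j l j3; case: (k.+1 %% m)%N => [|[|?]]; case: l => [|[|?]] //= []; lia.
have -> : twist (L1 i k) c = c.
  by case: k {km k'm LX LX'} => [|[|k]]; case: i i3 => [|[|[|i]]].
by rewrite pi3_label//; move: i3; case: (k.+1 %% m)%N => [|[|?]] //= + []; lia.
Qed.

Definition row_elt i := if i == 1%N then tau else sigma.

(** Positions 0 and 1 carry mutually inverse twists, so a full turn of the cycle is untwisted. *)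
Lemma twist_cycle2 i k c : (0 < i < 3)%N -> twist (L2 i k) c =
  match k with 0 => row_elt i c | 1 => (row_elt i)^-1 c | _ => c end.
Proof. by case: k => [|[|k]]; case: i => [|[|[|i]]]. Qed.

Lemma alpha_cycle2 i k c : (0 < i < 3)%N -> (k < m)%N -> C c ->
  alpha (gam (L2 i k) c) = gam (L2 i (k.+1 %% m)) (twist (L2 i k) c).
Proof.
move=> i3 km Cc; have k'm : (k.+1 %% m < m)%N by rewrite ltn_mod; lia.
have LX := cycle2_labX i3 k'm; have LX' := cycle2_labX i3 km.
have L1L2 : cycles_perm (cycles1 m) (L2 i k) = L2 i k.
  apply: cycles_perm1_notin.
  by move=> j l j3; case: (k) => [|[|?]]; case: l => [|[|?]] //= []; lia.
rewrite alpha_label ?L1L2// cycles_perm2//.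
rewrite pi3_label//; last exact: twistC.
by move: i3; case: (k.+1 %% m)%N => [|[|?]] //= + []; lia.
Qed.

Lemma alpha_row i j c : (i < 3)%N -> (3 <= j < n)%N -> C c ->
  alpha (gam [:: i; j] c) = gam [:: i; j] c.
Proof.
move=> i3 jn Cc; have xX : [:: i; j] \in X by apply: row_labX => //; lia.
have L1x : cycles_perm (cycles1 m) [:: i; j] = [:: i; j].
  by apply: cycles_perm1_notin => a [|[|?]] ? //= []; lia.
have L2x : cycles_perm (cycles2 m) [:: i; j] = [:: i; j].
  by apply: cycles_perm2_notin => a [|[|?]] ? //= []; lia.
rewrite alpha_label ?L1x ?L2x//.
have -> : twist [:: i; j] c = c.
  by case: j jn {xX L1x L2x} => [|[|[|j]]] // _; case: i i3 => [|[|[|i]]].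
by rewrite pi3_label// => -[]; lia.
Qed.

Lemma alpha_C c : C c -> alpha c = pi3 c.
Proof.
move=> Cc.
have L1x : cycles_perm (cycles1 m) [:: 0; 0]%N = [:: 0; 0]%N.
  by apply: cycles_perm1_notin => a [|[|?]] ? //= []; lia.
have L2x : cycles_perm (cycles2 m) [:: 0; 0]%N = [:: 0; 0]%N.
  by apply: cycles_perm2_notin => a [|[|?]] ? //= []; lia.
by have := alpha_label labX00 Cc; rewrite L1x L2x gam00 => /(_ labX00).
Qed.

Lemma alpha_onE e : E e -> alpha e = pi3 e.
Proof.
move=> Ee; rewrite alphaE 3!homeoM (homeoM (_ * _ * _)) (homeoM (_ * _)) (homeoM (_ ^ _)).
rewrite !conj_E ?labX11 ?labX12 ?labX21 ?labX22//; try exact: supportedV.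
by rewrite (enacts_fixE enact1 cycles1_labX Ee) (enacts_fixE enact2 cycles2_labX Ee).
Qed.

Lemma alpha_E i k e : (i < 2)%N -> (k < m)%N -> E e ->
  alpha (gam [:: 0; i; k]%N e) = gam [:: 0; i; k.+1 %% m]%N e.
Proof.
move=> i2 km Ee; rewrite -pi3E//; case: (E_cases i2 km Ee) => [[_ ->]|[_ Cy]].
  exact: alpha_onE.
exact: alpha_C.
Qed.

Lemma alpha_C_fix c : C c -> (forall y, y \in labY m -> ~ (gam y @` E) c) -> alpha c = c.
Proof. by move=> Cc nY; rewrite alpha_C// pi3_fix//; exact: C_notE. Qed.

Lemma alpha_G : G alpha.
Proof.
have GX x : x \in X -> G (gam x) by move=> xX; apply: (Phi_gamX hch).
have := GX _ labX11; have := GX _ labX12; have := GX _ labX21; have := GX _ labX22.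
by move=> *; rewrite alphaE !conjgE; do ![apply: (subgroupM hG)|apply: (subgroupV hG)].
Qed.

(** The pieces are regrouped by the action of [alpha]: the sets [E] and [C] on which [pi3] acts, the
    fixed pieces, the cycles of [pi1] and those of [pi2]. *)
Lemma label_cases p : E p \/ C p
  \/ (exists i j c, [/\ (i < 3)%N, (3 <= j < n)%N, C c & p = gam [:: i; j] c])
  \/ (exists i k c, [/\ (0 < i < 3)%N, (k < m)%N, C c & p = gam (L1 i k) c])
  \/ (exists i k c, [/\ (0 < i < 3)%N, (k < m)%N, C c & p = gam (L2 i k) c]).
Proof.
have [|[x [c [/mem_labX xX Cc pE]]]] := label_cover p; first by left.
right; move: xX => [[i [j [k [i3 j2 km xE]]]]|[i [j [i3 jn xE]]]]; rewrite {}xE in pE.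
  right; right; move: j j2 pE => [|[|//]] _ pE; [left|right]; exists i, k, c; split=> //;
    move: km pE; case: k => [|[|k]] //= /andP[]//.
case: (leqP 3 j) => j3; first by right; left; exists i, j, c; rewrite j3.
have [i0|i0] := posnP i.
  subst i; move: j j3 jn pE => [|[|[|//]]] _ jn pE.
  - by left; rewrite pE gam00.
  - by right; right; left; exists 1%N, 0%N, c; split=> //; lia.
  - by right; right; left; exists 2%N, 0%N, c; split=> //; lia.
right; right; move: j j3 jn pE => [|[|[|//]]] _ jn pE.
- by left; exists i, 1%N, c; split=> //; lia.
- by right; exists i, 1%N, c; split=> //; lia.
- by right; exists i, 0%N, c; split=> //; lia.
Qed.

(** * Orders of [alpha] and [beta] *)

Lemma notC_label x c : x \in X -> x <> [:: 0; 0]%N -> C c -> ~ C (gam x c).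
Proof.
move=> xX x0 Cc Cxc; apply: x0; apply: (@label_disjoint _ _ c (gam x c)) => //; first exact: labX00.
by rewrite gam00.
Qed.

Lemma beta_X i j k c : (i < 3)%N -> (j < n)%N -> C c ->
  (beta ^+ k) (gam [:: i; j] c) = gam [:: i; (j + k) %% n]%N c.
Proof.
move=> i3 jn Cc; apply: (expg_cyclic (P := fun j => gam [:: i; j] c)) => // l ln.
exact: beta_row.
Qed.

Lemma beta_order : has_order beta n.
Proof.
split; first lia.
  have fix_n p : beta p = p -> (beta ^+ n) p = p by exact: expg_fix.
  apply: homeoP => p; rewrite homeo1; have [Ep|[x [c [/mem_labX xX Cc ->]]]] := label_cover p.
    exact/fix_n/beta_E.
  case: xX => [[i [j [k [i3 j2 km xE]]]]|[i [j [i3 jn ->]]]].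
    by rewrite xE; apply/fix_n/beta_tail => //; apply/mem_labX; left; exists i, j, k.
  by rewrite beta_X// modnDr modn_small.
move=> j jn bj; have [c Cc] : C !=set0.
  have [e Ee] := Phi_E0 hch; exists (gam [:: 0; 1; 0]%N e); apply: labY_sub => //.
  by apply: labY_mem => //; lia.
(* The [j]-th power takes [C] to the piece [0j], which is disjoint from [C]. *)
have := @beta_X 0%N 0%N j c isT _ Cc; rewrite bj homeo1 gam00 homeo1 modn_small; last lia.
move=> /(_ _) h; have {h} cE := h ltac:(lia).
have jX : [:: 0; j]%N \in X by apply: row_labX; lia.
by apply: (@notC_label [:: 0; j]%N c) => //; [move=> []; lia|rewrite -cE].
Qed.

Lemma alpha_order : has_order alpha m.
Proof.
have m0 : (0 < m)%N by lia.
split=> //.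
  apply: homeoP => p; rewrite homeo1.
  have fix_m q : alpha q = q -> (alpha ^+ m) q = q by exact: expg_fix.
  have orbE i k e : (i < 2)%N -> (k < m)%N -> E e ->
      (alpha ^+ m) (gam [:: 0; i; k]%N e) = gam [:: 0; i; k]%N e.
    move=> i2 km Ee.
    rewrite (expg_cyclic (P := fun k => gam [:: 0; i; k]%N e) (l := m))//.
      by rewrite modnDr modn_small.
    by move=> l lm; exact: alpha_E.
  have [Ep|[Cp|[[i [j [c [i3 jn Cc ->]]]]|[[i [k [c [i3 km Cc ->]]]]|
    [i [k [c [i3 km Cc ->]]]]]]]] := label_cases p.
  - by have := orbE 0%N 0%N p; rewrite gam000; apply.
  - have [[y yY [e Ee <-]]|nY] := pselect (exists2 y, y \in labY m & (gam y @` E) p).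
      by have [i [k [i2 km -> _]]] := (mem_labY m y).1 yY; exact: orbE.
    by apply/fix_m/alpha_C_fix => // y yY Ep; apply: nY; exists y.
  - exact/fix_m/alpha_row.
  - rewrite (expg_cyclic (P := fun k => gam (L1 i k) c) (l := m))//.
      by rewrite modnDr modn_small.
    by move=> l lm; exact: alpha_cycle1.
  (* Two steps from position 0 apply [row_elt i] and then its inverse; after that the coordinate no
     longer changes. *)
  have turn d l : C d -> (2 <= l <= m)%N -> (alpha ^+ l) (gam (L2 i 0) d) = gam (L2 i (l %% m)) d.
    move=> Cd; elim: l => // l IH lm.
    have [l1|l1] : l = 1%N \/ (2 <= l < m)%N by lia.
      rewrite l1 expg2 homeoM alpha_cycle2// modn_small// twist_cycle2//.
      have Cd' : C (row_elt i d) by rewrite /row_elt; case: ifP => _; exact: supported_stable.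
      by rewrite alpha_cycle2// twist_cycle2// homeoK.
    rewrite expgSr_homeo IH; last lia.
    rewrite modn_small; last lia.
    rewrite alpha_cycle2//; last lia.
    by rewrite twist_cycle2//; case: l l1 {IH lm} => [|[|l]].
  have full d : C d -> (alpha ^+ m) (gam (L2 i 0) d) = gam (L2 i 0) d.
    by move=> Cd; rewrite turn ?modnn//; lia.
  have [k0|[k1|k2]] : k = 0%N \/ k = 1%N \/ (2 <= k <= m)%N by lia.
  - by rewrite k0 full.
  - have Cd : C ((row_elt i)^-1 c).
      by rewrite /row_elt; case: ifP => _; apply: supported_stable => //; exact: supportedV.
    rewrite k1; apply: (@expg_fix_commute _ 1 m _ _ _ (full _ Cd)).
    by rewrite expg1 alpha_cycle2// modn_small// twist_cycle2// homeoVK.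
  - apply: (@expg_fix_commute _ k m _ _ _ (full _ Cc)).
    by rewrite turn// modn_small.
(* A smaller power takes [E] to the copy labelled [00j], which lies in [C]. *)
move=> j jm aj; have [e Ee] := Phi_E0 hch.
have := @expg_cyclic alpha (fun k => gam [:: 0; 0; k]%N e) m j 0%N m0.
rewrite aj homeo1 gam000 homeo1 add0n modn_small; last lia.
move=> eE; have {}eE : e = gam [:: 0; 0; j]%N e.
  by apply: eE => i im; exact: alpha_E.
apply: (@C_notE e) => //; rewrite eE; apply: labY_sub => //.
by apply: labY_mem => //; lia.
Qed.

(** * Orbits of [alpha * beta] *)

Local Notation F := (alpha * beta).

Lemma F_start i c : (0 < i < 3)%N -> C c -> F (gam [:: 0; i]%N c) = gam [:: i; 1]%N c.
Proof.
move=> i3 Cc; rewrite homeoM (@alpha_cycle1 i 0)//; last lia.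
rewrite modn_small// /= beta_row//; [|lia|lia].
by rewrite modn_small//; lia.
Qed.

Lemma F_cycle1_step i k c : (0 < i < 3)%N -> (0 < k)%N -> (k.+1 < m)%N -> C c ->
  F (gam (L1 i k) c) = gam (L1 i k.+1) c.
Proof.
move=> i3 k0 km Cc; rewrite homeoM alpha_cycle1//; last lia.
rewrite modn_small//; case: k k0 km => // k _ km.
by rewrite /= beta_tail//; apply: (@cycle1_labX i k.+2).
Qed.

Lemma F_cycle1_end i c : (0 < i < 3)%N -> C c ->
  F (gam (L1 i m.-1) c) = gam [:: 0; i.+1 %% n]%N c.
Proof.
move=> i3 Cc; rewrite homeoM alpha_cycle1//; last lia.
rewrite prednK ?modnn /=; last lia.
by rewrite beta_row//; lia.
Qed.

(** [alpha] moves the piece [i2] to [i1] and applies [row_elt i]; [beta] moves it back. *)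
Lemma F_cycle2_fix i c : (0 < i < 3)%N -> C c ->
  F (gam [:: i; 2]%N c) = gam [:: i; 2]%N (row_elt i c).
Proof.
move=> i3 Cc; rewrite homeoM (@alpha_cycle2 i 0)//; last lia.
rewrite twist_cycle2// modn_small//= beta_row//; [|lia|lia|].
  by rewrite modn_small//; lia.
by rewrite /row_elt; case: ifP => _; exact: supported_stable.
Qed.

Lemma F_cycle2_step i k c : (0 < i < 3)%N -> (0 < k)%N -> (k.+1 < m)%N -> C c ->
  F (gam (L2 i k) c) = gam (L2 i k.+1) (twist (L2 i k) c).
Proof.
move=> i3 k0 km Cc; rewrite homeoM alpha_cycle2//; last lia.
rewrite modn_small//; have := twistC (L2 i k) Cc; case: k k0 km => // k _ km Ct.
by rewrite -[L2 i k.+2]/([:: i; 1; k.+2]%N) beta_tail//; apply: (@cycle2_labX i k.+2).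
Qed.

(** If [m = 2], the last position is position 1 and still carries a twist. Reduction modulo [n]
    covers [n = 3], where the row is already back at 0. *)
Lemma F_cycle2_end i c : (0 < i < 3)%N -> C c ->
  F (gam (L2 i m.-1) c) = gam [:: i; 3 %% n]%N (twist (L2 i m.-1) c).
Proof.
move=> i3 Cc; rewrite homeoM alpha_cycle2//; last lia.
rewrite prednK ?modnn; last lia.
by rewrite -[L2 i 0]/([:: i; 2]%N) beta_row//; [lia|exact: twistC].
Qed.

Lemma F_row i j c : (i < 3)%N -> (3 <= j < n)%N -> C c ->
  F (gam [:: i; j] c) = gam [:: i; j.+1 %% n]%N c.
Proof. by move=> i3 jn Cc; rewrite homeoM alpha_row// beta_row//; lia. Qed.

(** The value [j = n] stands for label 0 and zero steps; it occurs when [n = 3]. *)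
Lemma F_row_return i j c : (i < 3)%N -> (3 <= j <= n)%N -> C c ->
  (F ^+ (n - j)) (gam [:: i; j %% n]%N c) = gam [:: i; 0]%N c.
Proof.
move=> i3 + Cc; move dE : (n - j)%N => d; elim: d j dE => [|d IH] j dE jn.
  by rewrite (_ : j = n) ?modnn ?expg0//; lia.
rewrite expgS_homeo modn_small; last lia.
by rewrite F_row//; [apply: IH; lia|lia].
Qed.

Lemma F_cycle1_return i k c : (0 < i < 3)%N -> (0 < k < m)%N -> C c ->
  (F ^+ (m - k)) (gam (L1 i k) c) = gam [:: 0; i.+1 %% n]%N c.
Proof.
move=> i3 + Cc; move dE : (m - k)%N => d; elim: d k dE => [|d IH] k dE km; first lia.
rewrite expgS_homeo; have [kE|kE] : k = m.-1 \/ (k.+1 < m)%N by lia.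
  by rewrite kE F_cycle1_end// (_ : d = 0%N)//; lia.
by rewrite F_cycle1_step//; [apply: IH; lia|lia].
Qed.

Lemma F_cycle2_return i k c : (0 < i < 3)%N -> (0 < k < m)%N -> C c ->
  (F ^+ (m - k)) (gam (L2 i k) c) = gam [:: i; 3 %% n]%N (twist (L2 i k) c).
Proof.
move=> i3; move dE : (m - k)%N => d; elim: d k c dE => [|d IH] k c dE km Cc; first lia.
rewrite expgS_homeo; have [kE|kE] : k = m.-1 \/ (k.+1 < m)%N by lia.
  by rewrite kE F_cycle2_end// (_ : d = 0%N)//; lia.
have k0 : (0 < k)%N by lia.
rewrite F_cycle2_step// IH//; [|lia|exact: twistC].
by congr (gam _ _); case: (k) k0 => // l _; rewrite twist_cycle2.
Qed.

Lemma F_return c : C c ->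
  (F ^+ (4 * m + 3 * n - 11)) (gam [:: 0; 1]%N c) = (sigma * tau)^-1 c.
Proof.
move=> Cc; have Ct := supported_stable (supportedV sup_tau) Cc.
have Cs := supported_stable (supportedV sup_sigma) Ct.
(* The summands are the numbers of steps along the itinerary 01, 11, 13, 10, 02, 21, 23, 20, 03, 00,
   second digits modulo [n]. The passage from 11 contributes [tau^-1] and that from 21 contributes
   [sigma^-1]. *)
have -> : (4 * m + 3 * n - 11 = 1 + ((m - 1) + ((n - 3) + ((m - 1) + (1 + ((m - 1)
  + ((n - 3) + ((m - 1) + (n - 3)))))))))%N by lia.
have m1 : (0 < 1 < m)%N by lia.
have seg2 i d : (0 < i < 3)%N -> C d -> (F ^+ (m - 1)) (gam [:: i; 1]%N d) =
    gam [:: i; 3 %% n]%N ((row_elt i)^-1 d).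
  by move=> i3 Cd; have := F_cycle2_return i3 m1 Cd; rewrite twist_cycle2.
have seg1 i d : (0 < i < 3)%N -> C d -> (F ^+ (m - 1)) (gam [:: i; 0]%N d) =
    gam [:: 0; i.+1 %% n]%N d.
  by move=> i3 Cd; exact: (F_cycle1_return i3 m1 Cd).
have seg3 i d : (i < 3)%N -> C d -> (F ^+ (n - 3)) (gam [:: i; 3 %% n]%N d) =
    gam [:: i; 0]%N d.
  by move=> i3 Cd; apply: F_row_return => //; lia.
rewrite expgM_homeo expg1 F_start// expgM_homeo seg2// expgM_homeo seg3//.
rewrite expgM_homeo seg1// modn_small; last lia.
rewrite expgM_homeo expg1 F_start// expgM_homeo seg2// expgM_homeo seg3//.
by rewrite expgM_homeo seg1// seg3// gam00.
Qed.

Local Notation N := (4 * m + 3 * n - 10)%N.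

(** The first of the [N] steps takes [alpha p] to the piece [01]. The hypothesis is on [alpha p] so
    as to cover the points of [E] that [alpha] takes into [C]. *)
Lemma F_first_return p : C (alpha p) -> (F ^+ N) p = (sigma * tau)^-1 (alpha p).
Proof.
move=> Cp; have -> : N = (4 * m + 3 * n - 11).+1 by lia.
rewrite expgS_homeo homeoM; have := @beta_row 0%N 0%N (alpha p) isT _ Cp.
rewrite gam00 homeo1 modn_small; last lia.
by move=> ->; [exact: F_return|lia].
Qed.

(** [sigma * tau] fixes the copies of [E] in [C], so the return agrees with [alpha] there; the side
    condition excludes [E] itself as the target. *)
Lemma F_returnE i k e : (i < 2)%N -> (k < m)%N -> (0 < i + (k.+1 %% m))%N -> E e ->
  (F ^+ N) (gam [:: 0; i; k]%N e) = gam [:: 0; i; k.+1 %% m]%N e.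
Proof.
move=> i2 km ik Ee; have k'm : (k.+1 %% m < m)%N by rewrite ltn_mod; lia.
have yY := labY_mem i2 k'm ik.
rewrite F_first_return alpha_E//; last exact: labY_sub.
by apply: (@homeo_inj (sigma * tau)); rewrite homeoVK labY_fixed.
Qed.

Lemma F_E1_period k e : (k < m)%N -> E e ->
  (F ^+ (m * N)) (gam [:: 0; 1; k]%N e) = gam [:: 0; 1; k]%N e.
Proof.
move=> km Ee; rewrite mulnC expgnA.
rewrite (expg_cyclic (P := fun k => gam [:: 0; 1; k]%N e) (l := m))//.
  by rewrite modnDr modn_small.
by move=> l lm; rewrite F_returnE.
Qed.

Lemma F_E0_orbit k e : (k < m)%N -> E e -> (F ^+ (k * N)) e = gam [:: 0; 0; k]%N e.
Proof.
move=> + Ee; elim: k => [|k IH] km; first by rewrite expg0 gam000.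
have km' : (k.+1 %% m = k.+1)%N by rewrite modn_small.
rewrite mulSn addnC expgM_homeo IH; last lia.
by rewrite F_returnE ?km'//; lia.
Qed.

(** [m - 1] returns take [E] to its last copy in the cycle; one step of [alpha] then closes the
    cycle, as [beta] fixes [E]. *)
Lemma F_E0_period e : E e -> (F ^+ ((m - 1) * N + 1)) e = e.
Proof.
move=> Ee; rewrite expgM_homeo F_E0_orbit//; last lia.
rewrite expg1 homeoM alpha_E//; last lia.
rewrite (_ : (m - 1).+1 = m) ?modnn; last lia.
by rewrite gam000 beta_E.
Qed.

(** Off the copies of [E] the return map is [(sigma * tau)^-1], which preserves this part of [C] and
    has trivial [m]-th power. *)
Lemma F_C_period c : (sigma * tau) ^+ m = 1 -> C c ->
  (forall y, y \in labY m -> ~ (gam y @` E) c) -> (F ^+ (m * N)) c = c.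
Proof.
move=> stm Cc nY; pose P d := C d /\ forall y, y \in labY m -> ~ (gam y @` E) d.
have PF d : P d -> (F ^+ N) d = (sigma * tau)^-1 d.
  by move=> [Cd nd]; rewrite F_first_return alpha_C_fix.
have PS d : P d -> P ((sigma * tau)^-1 d).
  move=> [Cd nd]; split.
    by apply: supported_stable => //; apply: supportedV; exact: supportedM.
  move=> y yY [e Ee ed]; apply: (nd y yY); exists e => //.
  by rewrite -(labY_fixed yY Ee) ed homeoVK.
have PX k : P c -> P (((sigma * tau)^-1 ^+ k) c) /\
    ((F ^+ N) ^+ k) c = ((sigma * tau)^-1 ^+ k) c.
  move=> Pc; elim: k => [|k [IHP IH]]; first by rewrite !expg0.
  by rewrite !expgSr_homeo IH PF//; split=> //; exact: PS.
rewrite mulnC expgnA (proj2 (PX m (conj Cc nY))).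
by rewrite expVgn stm invg1.
Qed.

(* Off [C gamma_12] and [C gamma_22] the orbits of [alpha * beta] have length
   dividing [m N] or [(m - 1) N + 1]. *)
Definition F_exponent := (m * N * ((m - 1) * N + 1))%N.
Local Notation r := F_exponent.

Lemma F_period_base p : (sigma * tau) ^+ m = 1 -> C p \/ E p -> (F ^+ r) p = p.
Proof.
move=> stm; have d1 : (m * N %| r)%N by rewrite dvdn_mulr.
have d2 : ((m - 1) * N + 1 %| r)%N by rewrite dvdn_mull.
move=> [Cp|Ep]; last exact: (expg_fix_dvd d2 (F_E0_period Ep)).
have [[y yY [e Ee <-]]|nY] := pselect (exists2 y, y \in labY m & (gam y @` E) p).
  have [i [k [i2 km -> _]]] := (mem_labY m y).1 yY.
  case: i i2 => [|[|//]] _; last exact: (expg_fix_dvd d1 (F_E1_period km Ee)).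
  apply: (expg_fix_commute (F_E0_orbit km Ee)).
  exact: (expg_fix_dvd d2 (F_E0_period Ee)).
apply: (expg_fix_dvd d1); apply: F_C_period => // y yY Ep.
by apply: nY; exists y.
Qed.

(** Every piece other than [12] and [22] flows to [00]. Periodicity is pulled back from there to 20,
    02, 10 and 01 in turn, and then to the remaining labels. *)
Lemma F_period x c : (sigma * tau) ^+ m = 1 -> x \in X ->
  x <> [:: 1; 2]%N -> x <> [:: 2; 2]%N -> C c -> (F ^+ r) (gam x c) = gam x c.
Proof.
move=> stm + x12 x22; pose per y := forall c, C c -> (F ^+ r) (gam y c) = gam y c.
have per00 : per [:: 0; 0]%N.
  by move=> d Cd; rewrite gam00; apply: F_period_base => //; left.
have per_row i j : (i < 3)%N -> (3 <= j <= n)%N -> per [:: i; 0]%N -> per [:: i; j %% n]%N.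
  move=> i3 jn pi0 d Cd; apply: (expg_fix_later (F_row_return i3 jn Cd)); exact: pi0.
have per_row3 i : (i < 3)%N -> per [:: i; 0]%N -> per [:: i; 3 %% n]%N.
  by move=> i3; apply: per_row => //; lia.
have per1 i k : (0 < i < 3)%N -> (0 < k < m)%N -> per [:: 0; i.+1 %% n]%N -> per (L1 i k).
  by move=> i3 km pi0 d Cd; apply: (expg_fix_later (F_cycle1_return i3 km Cd)); exact: pi0.
have per2 i k : (0 < i < 3)%N -> (0 < k < m)%N -> per [:: i; 0]%N -> per (L2 i k).
  move=> i3 km pi0 d Cd; apply: (expg_fix_later (F_cycle2_return i3 km Cd)).
  by apply: per_row3 => //; [lia|exact: twistC].
have per0 i : (0 < i < 3)%N -> per [:: i; 1]%N -> per [:: 0; i]%N.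
  move=> i3 pe d Cd; apply: (@expg_fix_later _ 1 _ _ (gam [:: i; 1]%N d)); last exact: pe.
  by rewrite expg1 F_start.
have m1 : (0 < 1 < m)%N by lia.
have per20 : per [:: 2; 0]%N by apply: (per1 2%N 1%N) => //; exact: per_row3.
have per02 : per [:: 0; 2]%N by apply: per0 => //; exact: (per2 2%N 1%N).
have p02 : per [:: 0; 2 %% n]%N by rewrite modn_small.
have per10 : per [:: 1; 0]%N by exact: (per1 1%N 1%N).
have per01 : per [:: 0; 1]%N by apply: per0 => //; exact: (per2 1%N 1%N).
have peri0 i : (i < 3)%N -> per [:: i; 0]%N by case: i => [|[|[|]]].
move=> /mem_labX[[i [j [k [i3 j2 km xE]]]]|[i [j [i3 jn xE]]]]; subst x; move: c.
  have k1m : (0 < k < m)%N by lia.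
  case: j j2 {x12 x22} => [|[|//]] _.
    have -> : [:: i; 0; k]%N = L1 i k by case: k km {k1m} => [|[|]].
    apply: per1 => //; case: i i3 => [|[|[|]]] // _; exact: per_row3.
  have -> : [:: i; 1; k]%N = L2 i k by case: k km {k1m} => [|[|]].
  by apply: per2 => //; apply: peri0; lia.
have [j3|j3] := leqP 3 j.
  by rewrite -(modn_small jn); apply: per_row => //; [lia|exact: peri0].
case: i i3 j j3 jn x12 x22 => [|[|[|//]]] _ [|[|[|//]]] _ _ // _ _.
- exact: (per2 1%N 1%N).
- exact: (per2 2%N 1%N).
Qed.

Lemma F_exponentE : (sigma * tau) ^+ m = 1 ->
  F ^+ r = (tau ^+ r) ^ gam [:: 1; 2]%N * (sigma ^+ r) ^ gam [:: 2; 2]%N.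
Proof.
move=> stm; have str := supportedX r sup_tau; have ssr := supportedX r sup_sigma.
apply: homeoP => p; rewrite (homeoM (_ ^ _)).
have [Ep|[x [c [xX Cc ->]]]] := label_cover p.
  by rewrite !conj_E ?labX12 ?labX22// F_period_base//; right.
have F2 i k d : (0 < i < 3)%N -> C d ->
    (F ^+ k) (gam [:: i; 2]%N d) = gam [:: i; 2]%N ((row_elt i ^+ k) d).
  move=> i3 Cd; have sre : supported (row_elt i) C by rewrite /row_elt; case: ifP.
  elim: k => [|k IH]; first by rewrite !expg0.
  by rewrite !expgSr_homeo IH F_cycle2_fix//; apply: supported_stable => //; exact: supportedX.
rewrite conj_label ?labX12// conj_label ?labX22//; last first.
  by case: ifP => // _; exact: supported_stable.
case: (x =P [:: 2; 2]%N) => [->|x22]; first by rewrite F2.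
case: (x =P [:: 1; 2]%N) => [->|x12]; first by rewrite F2.
by rewrite F_period.
Qed.

(** * Conjugates of [alpha * beta] that restrict to [sigma] and [tau] on [C] *)

Local Notation ga := (beta ^- 2 * alpha^-1 * beta ^- 2).
Local Notation gb := (beta ^- 2 * alpha^-1 * beta^-1).

(** [beta ^- 2] takes [i2] to [i0], and [alpha^-1] takes [i0] back to [0i] along the cycle of
    [pi1]. *)
Lemma conj_b_row i c : (0 < i < 3)%N -> C c ->
  (beta ^- 2 * alpha^-1) (gam [:: i; 2]%N c) = gam [:: 0; i]%N c.
Proof.
move=> i3 Cc; rewrite homeoM.
have -> : gam [:: i; 2]%N c = (beta ^+ 2) (gam [:: i; 0]%N c).
  rewrite beta_X//; [|lia|lia].
  by rewrite add0n modn_small//; lia.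
rewrite homeoK; have -> : gam [:: i; 0]%N c = alpha (gam (L1 i 0) c).
  by rewrite alpha_cycle1 ?modn_small//; lia.
by rewrite homeoK.
Qed.

Lemma conj_a_label c : C c -> ga (gam [:: 2; 2]%N c) = c.
Proof.
move=> Cc; rewrite (homeoM (_ * _)) conj_b_row//.
have -> : gam [:: 0; 2]%N c = (beta ^+ 2) (gam [:: 0; 0]%N c).
  by rewrite beta_X//; [rewrite add0n modn_small//; lia|lia].
by rewrite homeoK gam00.
Qed.

Lemma beta_C c : C c -> beta c = gam [:: 0; 1]%N c.
Proof.
move=> Cc; have := @beta_row 0%N 0%N c isT _ Cc.
rewrite gam00 homeo1 => ->; last lia.
by rewrite modn_small//; lia.
Qed.

Lemma conj_b_label c : C c -> gb (gam [:: 1; 2]%N c) = c.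
Proof. by move=> Cc; rewrite (homeoM (_ * _)) conj_b_row// -beta_C// homeoK. Qed.

Lemma conj_aE : ga = gb * beta^-1.
Proof. by rewrite -!mulgA; congr (_ * (_ * _)); rewrite expg2 invgM. Qed.

Lemma stabilises_conj (g s : HCS) x : supported s C ->
  (forall c, C c -> F (gam x c) = gam x (s c)) -> (forall c, C c -> g (gam x c) = c) ->
  stabilises_and_agrees (F ^ g) s C.
Proof.
move=> ss Fx gx; have agree c : C c -> (F ^ g) c = s c.
  move=> Cc; have -> : (F ^ g) c = g (F (g^-1 c)) by [].
  have -> : g^-1 c = gam x c by rewrite -[in LHS](gx c Cc) homeoK.
  by rewrite Fx// gx//; exact: supported_stable.
split=> //; apply/seteqP; split=> [_ [c Cc <-]|c Cc].
  by rewrite agree//; exact: supported_stable.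
have Cs : C (s^-1 c) by apply: supported_stable => //; exact: supportedV.
by exists (s^-1 c) => //; rewrite agree// homeoVK.
Qed.

Lemma a_agrees : stabilises_and_agrees (F ^ ga) sigma C.
Proof.
apply: (stabilises_conj (x := [:: 2; 2]%N)) => // c Cc; first by rewrite F_cycle2_fix.
exact: conj_a_label.
Qed.

Lemma b_agrees : stabilises_and_agrees (F ^ gb) tau C.
Proof.
apply: (stabilises_conj (x := [:: 1; 2]%N)) => // c Cc; first by rewrite F_cycle2_fix.
exact: conj_b_label.
Qed.

(** Each of the two powers has a factor supported on [C]; the other factor is a copy of [tau ^+ r]
    on the preimage of [C] under [beta], or a copy of [sigma ^+ r] on its image. These three sets
    are disjoint, so only the factors on [C] enter the commutator. *)
Lemma commutator_exponent : (sigma * tau) ^+ m = 1 ->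
  [~ (F ^ ga) ^+ r, (F ^ gb) ^+ r] = [~ sigma ^+ r, tau ^+ r].
Proof.
move=> stm; have str := supportedX r sup_tau; have ssr := supportedX r sup_sigma.
have conjF g : (F ^ g) ^+ r =
    (tau ^+ r) ^ (gam [:: 1; 2]%N * g) * (sigma ^+ r) ^ (gam [:: 2; 2]%N * g).
  by rewrite -conjXg F_exponentE// conjMg !conjgM.
rewrite !conjF.
rewrite (@conj_agree (gam [:: 1; 2]%N * ga) beta^-1 _ _ str); last first.
  by move=> c Cc; rewrite conj_aE (homeoM (gam _)) (homeoM (_ * _)) conj_b_label.
rewrite (@conj_agree (gam [:: 2; 2]%N * ga) 1 _ _ ssr); last first.
  by move=> c Cc; rewrite (homeoM (gam _)) conj_a_label.
rewrite (@conj_agree (gam [:: 1; 2]%N * gb) 1 _ _ str); last first.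
  by move=> c Cc; rewrite (homeoM (gam _)) conj_b_label.
rewrite (@conj_agree (gam [:: 2; 2]%N * gb) beta _ _ ssr); last first.
  move=> c Cc; have -> : gb = ga * beta by rewrite conj_aE mulgVK.
  by rewrite (homeoM (gam _)) (homeoM (_ * _)) conj_a_label.
rewrite !conjg1.
have n01 x c : x \in X -> x <> [:: 0; 0]%N -> C c -> ~ C (gam x c) by exact: notC_label.
have X01 : [:: 0; 1]%N \in X by apply: row_labX; lia.
have X02 : [:: 0; 2]%N \in X by apply: row_labX; lia.
have dV p : ((beta^-1)%g @` C) p -> ~ C p.
  by move=> /homeo_imageP; rewrite invgK => Cbp Cp; apply: (n01 [:: 0; 1]%N p); rewrite -?beta_C.
have dB p : (beta @` C) p -> ~ C p by move=> [c Cc <-]; rewrite beta_C//; exact: n01.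
have sV := supportedJ (h := beta^-1) str; have sB := supportedJ (h := beta) ssr.
apply: commg_factors.
- exact: disjoint_supports_commute sV str dV.
(* [beta] would take a common point into both [C] and the piece [02], which differ because
   [n >= 3]. *)
- apply: disjoint_supports_commute sV sB _ => p /homeo_imageP + [c Cc cp].
  rewrite invgK -cp (beta_C Cc) beta_row//; [|lia].
  by rewrite modn_small; [exact: n01|lia].
- exact: disjoint_supports_commute sB ssr dB.
- exact: disjoint_supports_commute sB str dB.
Qed.


(** * Supports of [alpha] and [beta] *)

Local Notation YE := (\bigcup_(y in [set` labY m]) (gam y @` E)).

Hypotheses (hvig : vigorous G) (hsimple : is_simple G) (cC : clopen C).

Lemma clopenE : clopen E. Proof. exact: Phi_clopenE hch. Qed.

Lemma clopenCYE : clopen (C `\` YE).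
Proof.
apply: clopenD => //; apply: clopen_bigcup_seq => y _; apply: clopen_image; exact: clopenE.
Qed.

Lemma alpha_fixes : fixes_pointwise alpha (C `\` YE).
Proof. by move=> p [Cp nY]; apply: alpha_C_fix => // y yY yp; apply: nY; exists y. Qed.

Lemma beta_fixes : fixes_pointwise beta E.
Proof. by move=> e Ee; exact: beta_E. Qed.

Lemma small_support_fixes g V : G g -> clopen V -> V !=set0 -> fixes_pointwise g V ->
  small_support G g.
Proof.
move=> Gg cV [p Vp] gV; exists (~` V); split.
- exact: clopenC.
- by split=> // /(_ p I).
- by split=> //; rewrite setCK.
Qed.

Lemma C_nonempty : C !=set0.
Proof.
have [e Ee] := Phi_E0 hch; exists (gam [:: 0; 1; 0]%N e); apply: labY_sub => //.
by apply: labY_mem => //; lia.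
Qed.

(** A point moved by [sigma * tau] lies in [C] and avoids all copies of [E]. *)
Lemma CYE_nonempty : sigma * tau <> 1 -> (C `\` YE) !=set0.
Proof.
move=> st1; have [p stp] : exists p, (sigma * tau) p <> p.
  by apply: contrapT => /forallNP sp; apply: st1; apply: homeoP => p; exact: contrapT (sp p).
exists p; split.
  by apply: contrapT => nC; apply: stp; apply: (supportedM sup_sigma sup_tau).
by move=> [y yY [e Ee ep]]; apply: stp; rewrite -ep labY_fixed.
Qed.

(** For [n > 3] the piece [03] is fixed. For [n = 3] the part of [C] outside the copies of [E] is
    fixed, and it is empty only in the degenerate case. *)
Lemma alpha_small_support : ~ Phi_degenerate m n C sigma tau gam E -> small_support G alpha.
Proof.
move=> ndeg; have [n3|n3] := eqVneq n 3%N; last first.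
  apply: (@small_support_fixes _ (gam [:: 0; 3]%N @` C)) => //.
  - exact: alpha_G.
  - exact: clopen_image.
  - by have [c Cc] := C_nonempty; exists (gam [:: 0; 3]%N c); exists c.
  - by move=> _ [c Cc <-]; rewrite alpha_row//; lia.
apply: (@small_support_fixes _ (C `\` YE)) => //.
- exact: alpha_G.
- exact: clopenCYE.
- have [st1|st1] := pselect (sigma * tau = 1); last exact: CYE_nonempty.
  apply: contrapT => ne; apply: ndeg; split=> //.
  apply/seteqP; split=> [_ [y yY [e Ee <-]]|c Cc]; first exact: labY_sub.
  by apply: contrapT => nY; apply: ne; exists c.
- exact: alpha_fixes.
Qed.

Lemma beta_small_support : small_support G beta.
Proof.
apply: (@small_support_fixes _ E) => //; [exact: clopenE|exact: Phi_E0 hch|].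
exact: beta_fixes.
Qed.

(** * Generation of [G] *)

Section Generation.
Variable H : set HCS.
Hypotheses (sH : is_subgroup H) (HG : H `<=` G) (Halpha : H alpha) (Hbeta : H beta).

(** [E] is adjoined so that any two such sets overlap, as [comm_closedU] requires. *)
Local Notation good A := (comm_closed G H (A `|` E)).

Lemma alpha_image_E e : E e -> alpha e = gam [:: 0; 0; 1]%N e.
Proof.
move=> Ee; have := @alpha_E 0%N 0%N e isT _ Ee; rewrite gam000 homeo1 => ->; last lia.
by rewrite modn_small//; lia.
Qed.

Lemma alpha_E_C e : E e -> C (alpha e).
Proof.
by move=> Ee; rewrite alpha_image_E//; apply: labY_sub => //; apply: labY_mem => //; lia.
Qed.

(** [alpha] takes the last copy of [E] in its cycle, which lies in [C], back to [E]; so [C] and its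
    image together contain [E]. They overlap because the second cycle of [pi3] stays inside [C]. *)
Lemma good_C : comm_closed G H C -> good C.
Proof.
move=> KC; have cEv := clopenE; have [e Ee] := Phi_E0 hch.
have cCa := clopen_image alpha cC.
have labC i k : (i < 2)%N -> (0 < i + k)%N -> (k < m)%N -> C (gam [:: 0; i; k]%N e).
  by move=> ? ? ?; apply: labY_sub => //; exact: labY_mem.
apply: (@comm_closedS G H (C `|` alpha @` C)).
  move=> p [Cp|Ep]; [by left|right; exists (gam [:: 0; 0; m.-1]%N p)].
    by apply: labY_sub => //; apply: labY_mem => //; lia.
  rewrite alpha_E//; last lia.
  by rewrite prednK ?modnn ?gam000//; lia.
apply: comm_closedU => //; last exact: comm_closedJ.
exists (alpha (gam [:: 0; 1; 0]%N e)); split.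
  rewrite alpha_E//; last lia.
  by apply: labC; rewrite ?ltn_mod; lia.
by exists (gam [:: 0; 1; 0]%N e) => //; apply: labC; lia.
Qed.

(** [alpha] takes [E] into [C], so the image of the union of [A] and [E] overlaps the union of [C]
    and [E]; joining the latter restores [E]. *)
Lemma good_alpha A : clopen A -> good C -> good A -> good (alpha @` A).
Proof.
move=> cA gC gA; have cEv := clopenE; have cAE : clopen (A `|` E) by exact: clopenU.
apply: (@comm_closedS G H (alpha @` (A `|` E) `|` (C `|` E))).
  by move=> p [[q Aq <-]|Ep]; [left; exists q => //; left|right; right].
apply: comm_closedU => //; [exact: clopen_image|exact: clopenU| |exact: comm_closedJ].
have [e Ee] := Phi_E0 hch; exists (alpha e); split; first by exists e => //; right.
by left; exact: alpha_E_C.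
Qed.

Lemma good_beta A : clopen A -> good A -> good (beta @` A).
Proof.
move=> cA gA; have cAE : clopen (A `|` E) by apply: clopenU => //; exact: clopenE.
apply: (@comm_closedS G H (beta @` (A `|` E))); last exact: comm_closedJ.
move=> p [[q Aq <-]|Ep]; first by exists q => //; left.
by exists p; [right|exact: beta_E].
Qed.

Local Notation goodX x := (good (gam x @` C)).

Lemma goodX_alpha x y : good C -> goodX x ->
  (forall c, C c -> exists2 d, C d & alpha (gam x d) = gam y c) -> goodX y.
Proof.
move=> gC gx xy; have cx := clopen_image (gam x) cC.
apply: comm_closedS (good_alpha cx gC gx) => p [[c Cc <-]|Ep]; last by right.
by left; have [d Cd <-] := xy c Cc; exists (gam x d) => //; exists d.
Qed.

Lemma goodX_beta i j : (i < 3)%N -> (j.+1 < n)%N -> goodX [:: i; j] -> goodX [:: i; j.+1].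
Proof.
move=> i3 jn gx; have cx := clopen_image (gam [:: i; j]) cC.
apply: comm_closedS (good_beta cx gx) => p [[c Cc <-]|Ep]; last by right.
left; exists (gam [:: i; j] c); first by exists c.
by rewrite beta_row ?modn_small//; lia.
Qed.

Lemma goodX_row i j : (i < 3)%N -> (j < n)%N -> goodX [:: i; 0]%N -> goodX [:: i; j].
Proof.
move=> i3 + gi; elim: j => [//|j IH] jn.
by apply: goodX_beta => //; apply: IH; lia.
Qed.

Lemma twist_surj x c : C c -> exists2 d, C d & twist x d = c.
Proof.
move=> Cc; have st := supportedV sup_tau; have ss := supportedV sup_sigma.
rewrite /twist.
case: (x == [:: 2; 2]%N); first by exists (sigma^-1 c); rewrite ?homeoVK//; exact: supported_stable.
case: (x == [:: 2; 1]%N); first by exists (sigma c); rewrite ?homeoK//; exact: supported_stable.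
case: (x == [:: 1; 2]%N); first by exists (tau^-1 c); rewrite ?homeoVK//; exact: supported_stable.
case: (x == [:: 1; 1]%N); first by exists (tau c); rewrite ?homeoK//; exact: supported_stable.
by exists c.
Qed.

(** [beta] leads from [00] along row 0, [alpha] from [0i] along the cycles of [pi1], [beta] from
    [i0] along rows 1 and 2, and [alpha] from [i2] along the cycles of [pi2]. *)
Lemma goodX_all x : comm_closed G H C -> x \in X -> goodX x.
Proof.
move=> /good_C gC; have g00 : goodX [:: 0; 0]%N.
  by rewrite gam00; have -> : [set homeo_fun 1 c | c in C] = C by rewrite image_id.
have g1 i k : (0 < i < 3)%N -> (k < m)%N -> goodX (L1 i k).
  move=> i3; elim: k => [|k IH] km; first by apply: goodX_row => //; lia.
  apply: (goodX_alpha (x := L1 i k)) => //; first by apply: IH; lia.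
  by move=> c Cc; exists c => //; rewrite alpha_cycle1 ?modn_small//; lia.
have grow i j : (i < 3)%N -> (j < n)%N -> goodX [:: i; j].
  move=> i3 jn; apply: goodX_row => //; case: i i3 => [//|i] i3.
  by apply: (g1 _ 1%N); lia.
have g2 i k : (0 < i < 3)%N -> (k < m)%N -> goodX (L2 i k).
  move=> i3; elim: k => [|k IH] km; first by apply: grow; lia.
  apply: (goodX_alpha (x := L2 i k)) => //; first by apply: IH; lia.
  move=> c Cc; have [d Cd dc] := twist_surj (L2 i k) Cc.
  by exists d => //; rewrite alpha_cycle2 ?modn_small ?dc//; lia.
move=> /mem_labX[[i [j [k [i3 j2 km ->]]]]|[i [j [i3 jn ->]]]]; last exact: grow.
have k' : (k < m)%N by lia.
case: j j2 => [|[|//]] _.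
  by have := g1 i k i3 k'; case: k km {k'} => [|[|]].
by have := g2 i k i3 k'; case: k km {k'} => [|[|]].
Qed.

Lemma comm_closed_all : comm_closed G H C -> G `<=` H.
Proof.
move=> KC; apply: (comm_closedT_sub hG hvig hsimple sH).
suff [V [cV EV XV KV]] : exists V, [/\ clopen V, E `<=` V,
    forall x, x \in X -> gam x @` C `<=` V & comm_closed G H V].
  apply: comm_closedS KV => p _; have [Ep|[x [c [xX Cc ->]]]] := label_cover p; first exact: EV.
  by apply: (XV x) => //; exists c.
(* The induction runs over lists of labels contained in [X], joining one piece at a time through
   [E]. *)
have : {subset X <= X} by [].
elim: {-2}X => [_|x s IH sX].
  exists (C `|` E); split=> //; [by apply: clopenU => //; exact: clopenE|exact: good_C].
have [V [cV EV sV KV]] : exists V, [/\ clopen V, E `<=` V,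
    forall x, x \in s -> gam x @` C `<=` V & comm_closed G H V].
  by apply: IH => y ys; apply: sX; rewrite inE ys orbT.
have cx : clopen (gam x @` C `|` E) by apply: clopenU; [exact: clopen_image|exact: clopenE].
exists (V `|` (gam x @` C `|` E)); split.
- exact: clopenU.
- by move=> e Ee; left; exact: EV.
- move=> y; rewrite inE => /predU1P[->|ys] p yp; [by right; left|by left; apply: (sV y)].
- apply: comm_closedU => //.
    by have [e Ee] := Phi_E0 hch; exists e; split; [exact: EV|right].
  by apply: goodX_all => //; apply: sX; rewrite inE eqxx.
Qed.

(** The two conjugates act on [C] as [sigma] and [tau], so [H] realises every element of [G_C]
    there. It also contains the nontrivial commutator of the powers, an element of [G_C], and
    [comm_closed_of_conj] applies. *)
Lemma generate_all : (sigma * tau) ^+ m = 1 ->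
  rigid_stab G C = generated [set sigma; tau] ->
  [~ sigma ^+ F_exponent, tau ^+ F_exponent] <> 1 -> G `<=` H.
Proof.
move=> stm genC k1; have HF : H F by exact: subgroupM.
have Hga : H ga.
  by apply: subgroupM => //; [apply: subgroupM => //|]; apply: subgroupV => //; exact: subgroupX.
have Hgb : H gb.
  by apply: subgroupM => //; [apply: subgroupM => //|]; apply: subgroupV => //; exact: subgroupX.
have Ha : H (F ^ ga) by exact: subgroupJ.
have Hb : H (F ^ gb) by exact: subgroupJ.
have [rs_s rs_t] : rigid_stab G C sigma /\ rigid_stab G C tau by [].
have sC := rigid_stab_subgroup hG C.
apply: comm_closed_all; apply: (comm_closed_of_conj hG hvig sH cC _ k1).
- by apply: subgroupR => //; exact: subgroupX.
- by rewrite -commutator_exponent//; apply: subgroupR => //; exact: subgroupX.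
rewrite genC; suff : generated [set sigma; tau] `<=`
    [set w | rigid_stab G C w /\ exists2 h, H h & forall c, C c -> h c = w c].
  by move=> sub w /sub [].
apply: generated_sub; last first.
  move=> _ [->|->]; split=> //; [exists (F ^ ga)|exists (F ^ gb)] => //.
    exact: a_agrees.2.
  exact: b_agrees.2.
split=> [|v w [rv [h Hh hv]] [rw [k Hk kw]]|w [rw [h Hh hw]]].
- by split; [exact: subgroup1|exists 1 => //; exact: subgroup1].
- split; first exact: subgroupM.
  exists (h * k); first exact: subgroupM.
  by move=> c Cc; rewrite !homeoM hv// kw//; apply: supported_stable => //; exact: rv.2.
- split; first exact: subgroupV.
  exists h^-1; first exact: subgroupV.
  move=> c Cc; apply: (homeo_inj (g := h)); rewrite homeoVK hw ?homeoVK//.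
  by apply: supported_stable => //; apply: supportedV; exact: rw.2.
Qed.

End Generation.

(** * Reflections *)

(** The reflections [-j] and [-1 - j] modulo [n]. Followed by [beta] they become [1 - j] and [-j]:
    the first fixes label 0 before this composition, the second after it. *)
Definition reflect_label (b : bool) (x : seq nat) : seq nat :=
  if x is [:: i; j] then [:: i; if b then (n - j) %% n else n.-1 - j]%N else x.

Lemma reflect_labelP b i j : (j < n)%N -> exists2 k, (k < n)%N &
  reflect_label b [:: i; j] = [:: i; k] /\ reflect_label b [:: i; k] = [:: i; j].
Proof.
move=> jn; rewrite /=; case: b; last first.
  by exists (n.-1 - j)%N; [lia|split=> //; congr [:: _; _]; lia].
exists ((n - j) %% n)%N; first by rewrite ltn_mod; lia.
split=> //; congr [:: _; _]; case: (posnP j) => [->|j0].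
  by rewrite subn0 modnn subn0 modnn.
by rewrite (@modn_small (n - j)) ?subKn ?modn_small//; lia.
Qed.

Definition rows := [seq [:: i; j] | i <- iota 0 3, j <- iota 0 n].

Lemma mem_rows x : x \in rows <-> exists i j, [/\ (i < 3)%N, (j < n)%N & x = [:: i; j]].
Proof.
split=> [/allpairsP[[i j] /= [+ + ->]]|[i [j [i3 jn ->]]]].
  by rewrite (mem_iota 0 3) mem_iota => i3 jn; exists i, j.
by apply/allpairsP; exists (i, j); split; rewrite //= ?(mem_iota 0 3) ?mem_iota.
Qed.

Lemma rows_labX x : x \in rows -> x \in X.
Proof. by move=> /mem_rows[i [j [i3 jn ->]]]; exact: row_labX. Qed.

Hypothesis heven : even_class G C.

(* [C] is the union of two halves exchanged by [mu]. The same reflection is used on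
   corresponding points of both halves, as single swaps need not lie in [G]. *)
Lemma reflection D : clopen D -> D !=set0 -> D `<=` C -> exists g (flag : CS -> bool) V1 V2,
  [/\ G g, [/\ clopen V1, V1 !=set0, V1 `<=` D & forall c, V1 c -> flag c],
    [/\ clopen V2, V2 !=set0, V2 `<=` D & forall c, V2 c -> flag c = false],
    forall i j c, (i < 3)%N -> (j < n)%N -> C c ->
      g (gam [:: i; j] c) = gam (reflect_label (flag c) [:: i; j]) c &
    forall p, (forall x, x \in rows -> ~ (gam x @` C) p) -> g p = p].
Proof.
move=> cD D0 DC; have [W [mu [cW Gmu Wmu CE]]] := even_halves hG heven.
have [K [V1 [V2 [cK KW [cV1 V10 V1D V1K] [cV2 V20 V2D V2K]]]]] :
    exists K V1 V2, [/\ clopen K, K `<=` W,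
    [/\ clopen V1, V1 !=set0, V1 `<=` D & forall c, V1 c -> K c \/ K (mu^-1 c)] &
    [/\ clopen V2, V2 !=set0, V2 `<=` D & forall c, V2 c -> ~ (K c \/ K (mu^-1 c))]].
  (* [K] has to lie in [W], but [D] may meet only the other half. In that case [V1] and [V2] are
     images under [mu], which is why the flag also looks at [mu^-1 c]. *)
  have [d Dd] := D0; have := DC _ Dd; rewrite {1}CE => -[Wd|[w Ww wd]].
    have [K [cK K0 KDW DWK]] := clopen_split (clopenI cD cW) (ex_intro _ d (conj Dd Wd)).
    exists K, K, ((D `&` W) `\` K); split=> //; first by move=> c /KDW [].
      by split=> // c; [move=> /KDW []|left].
    split; [by apply: clopenD => //; exact: clopenI|by []|by move=> c [[]]|].
    move=> c [[Dc Wc] nK] [//|/KDW[_ Wc']].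
    by apply: (Wmu _ Wc'); rewrite homeoVK.
  have cDW : clopen (mu @^-1` D `&` W) by apply: clopenI => //; exact: clopen_preimage.
  have [|K [cK K0 KDW DWK]] := clopen_split cDW; first by exists w; split=> //=; rewrite wd.
  exists K, (mu @` K), (mu @` ((mu @^-1` D `&` W) `\` K)); split=> //; first by move=> c /KDW [].
    split; [exact: clopen_image|by have [k Kk] := K0; exists (mu k); exists k| |].
      by move=> _ [k /KDW[]] + _ <-.
    by move=> _ [k Kk <-]; right; rewrite homeoK.
  split.
  - by apply: clopen_image; apply: clopenD.
  - by have [k kP] := DWK; exists (mu k); exists k.
  - by move=> _ [k [[]] + _ _ <-].
  - move=> _ [k [[_ Wk] nK] <-] [/KDW[_ Wmk]|]; last by rewrite homeoK.
    exact: (Wmu k).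
have GX x : x \in X -> G (gam x) by move=> xX; apply: (Phi_gamX hch).
have [||||g Gg [gW gfix]] := @paired_involution G hG hvig hsimple _ gam rows W K mu
    reflect_label _ Gmu cW cK Wmu.
- by move=> x /rows_labX; exact: GX.
- by rewrite -CE => x y c d /rows_labX xX /rows_labX yX; exact: label_disjoint.
- move=> b x /mem_rows[i [j [i3 jn ->]]].
  have [k kn [-> kj]] := reflect_labelP b i jn; rewrite kj; split=> //.
  by apply/mem_rows; exists i, k.
- have [e Ee] := Phi_E0 hch; exists e => x /rows_labX xX; rewrite -CE => -[c Cc ce].
  by apply: (@label_notE x c) => //; rewrite ce.
exists g, (fun c => `[< K c \/ K (mu^-1 c) >]), V1, V2; split=> //.
- by split=> // c /V1K ?; apply/asboolP.
- by split=> // c /V2K ?; apply/asboolPn.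
- move=> i j c i3 jn; rewrite {1}CE => Cc; have xr : [:: i; j] \in rows.
    by apply/mem_rows; exists i, j.
  case: Cc => [Wc|[w Ww <-]].
    have [-> _] := gW _ _ xr Wc; congr (gam (reflect_label _ _) c).
    apply: asbool_equiv_eq; split=> [|[//|/KW Wc']]; first by left.
    by case: (Wmu _ Wc'); rewrite homeoVK.
  have [_ ->] := gW _ _ xr Ww; congr (gam (reflect_label _ _) _).
  apply: asbool_equiv_eq; rewrite homeoK; split=> [|[/KW Wm|//]]; first by right.
  by case: (Wmu w Ww).
- by move=> p pP; apply: gfix; rewrite -CE.
Qed.

(** * Strongly minimal generating sets *)

(** [beta] alone fixes [E], and [alpha] alone fixes the part of [C] outside the copies of [E], which
    is nonempty as [sigma * tau] is not trivial. *)
Lemma pair_generation : sigma * tau <> 1 -> (sigma * tau) ^+ m = 1 ->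
  rigid_stab G C = generated [set sigma; tau] ->
  [~ sigma ^+ F_exponent, tau ^+ F_exponent] <> 1 ->
  strongly_minimal_generating G [set alpha; beta] /\ ([set alpha; beta] #= `I_2)%card.
Proof.
move=> st1 stm genC k1; have CYE0 := CYE_nonempty st1.
have ab : alpha <> beta.
  move=> ab; have [e Ee] := Phi_E0 hch; have Cae := alpha_E_C Ee.
  by apply: (C_notE Cae); rewrite ab beta_E.
split; last exact: card_set2.
split.
  have sab : generated [set alpha; beta] `<=` G.
    by apply: generated_sub => // _ [->|->] //; exact: alpha_G.
  apply/seteqP; split=> //; apply: generate_all => //.
  - exact: generated_subgroup.
  - by apply: sub_generated; left.
  - by apply: sub_generated; right.
move=> Y YX; have [x [] -> nY] := properset_missing YX.
  exists E; split; [exact: clopenE|exact: Phi_E0 hch|move=> g Yg].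
  by case: (YX.1 g Yg) => gE; [case: nY; rewrite -gE|rewrite gE; exact: beta_fixes].
exists (C `\` YE); split=> //; [exact: clopenCYE|move=> g Yg].
by case: (YX.1 g Yg) => gE; [rewrite gE; exact: alpha_fixes|case: nY; rewrite -gE].
Qed.

Lemma involution_of_square (g : HCS) p : (forall q, g (g q) = q) -> g p <> p -> is_involution g.
Proof.
move=> gg gp; split=> //.
  by apply: homeoP => q; rewrite expg2 homeoM gg.
by case=> [|[|[]]] // _ g1; apply: gp; rewrite -[g]expg1 g1.
Qed.

Lemma rows_or_not p : (exists i j c, [/\ (i < 3)%N, (j < n)%N, C c & p = gam [:: i; j] c]) \/
  (forall x, x \in rows -> ~ (gam x @` C) p).
Proof.
have [h|h] := pselect (exists i j c, [/\ (i < 3)%N, (j < n)%N, C c & p = gam [:: i; j] c]).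
  by left.
by right=> x /mem_rows[i [j [i3 jn ->]]] [c Cc cp]; apply: h; exists i, j, c.
Qed.

Lemma beta_fix_notrow p : (forall x, x \in rows -> ~ (gam x @` C) p) -> beta p = p.
Proof.
move=> pP; apply: enactb.2 => x; rewrite cycles_betaE => /mem_familyP[i [j [+ jn ->]]].
by rewrite mem_iota => i3; apply: pP; apply/mem_rows; exists i, j.
Qed.

(** The reflection [g] fixes [V1], [d = g * beta] fixes [V2], [alpha] fixes both sets, and [g] and
    [d] fix [E]; so any two of the three generators fix a common nonempty clopen set. *)
Lemma triple_generation : sigma * tau <> 1 -> (sigma * tau) ^+ m = 1 ->
  rigid_stab G C = generated [set sigma; tau] ->
  [~ sigma ^+ F_exponent, tau ^+ F_exponent] <> 1 ->
  exists gamma delta : HCS, [/\ G gamma /\ G delta,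
    is_involution gamma /\ is_involution delta, beta = gamma * delta,
    strongly_minimal_generating G [set alpha; gamma; delta] &
    ([set alpha; gamma; delta] #= `I_3)%card].
Proof.
move=> st1 stm genC k1; have cCYE := clopenCYE.
have [g [flag [V1 [V2 [Gg [cV1 V10 V1D V1f] [cV2 V20 V2D V2f] gR gfix]]]]] :=
  reflection cCYE (CYE_nonempty st1) (@subDsetl _ _ _).
have gg p : g (g p) = p.
  have [[i [j [c [i3 jn Cc ->]]]]|pP] := rows_or_not p; last by rewrite !gfix.
  by have [k kn [h1 h2]] := reflect_labelP (flag c) i jn; rewrite gR// h1 gR// h2.
have gV : g^-1 = g by apply: homeoP => p; apply: (homeo_inj (g := g)); rewrite homeoVK gg.
pose d := g * beta.
have dR i j c : (i < 3)%N -> (j < n)%N -> C c ->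
    d (gam [:: i; j] c) = gam [:: i; (if flag c then (n.+1 - j) %% n else (n - j) %% n)%N] c.
  move=> i3 jn Cc; have [k kn [h1 _]] := reflect_labelP (flag c) i jn.
  rewrite homeoM gR// h1 beta_row//; congr (gam [:: _; _] c).
  case: h1; case: ifP => _ <-; last by congr (_ %% _)%N; lia.
  by rewrite -addn1 modnDml; congr (_ %% _)%N; lia.
have dfix p : (forall x, x \in rows -> ~ (gam x @` C) p) -> d p = p.
  by move=> pP; rewrite homeoM gfix// beta_fix_notrow.
have n1n : (n.+1 %% n = 1)%N by rewrite -add1n modnDr modn_small//; lia.
have dd p : d (d p) = p.
  have [[i [j [c [i3 jn Cc ->]]]]|pP] := rows_or_not p; last by rewrite !dfix.
  have kn : ((if flag c then (n.+1 - j) %% n else (n - j) %% n) < n)%N.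
    by case: ifP => _; rewrite ltn_mod; lia.
  rewrite dR// dR//; congr (gam [:: _; _] c); case: (flag c).
    have [j1|[j1|j1]] : (j = 0 \/ j = 1 \/ 2 <= j)%N by lia.
    - by rewrite j1 subn0 n1n subn1 /= modnn.
    - by rewrite j1 subn1 /= modnn subn0.
    - by rewrite (@modn_small (n.+1 - j)) ?subKn ?modn_small//; lia.
  have [->|j1] := posnP j; first by rewrite subn0 modnn subn0 modnn.
  by rewrite (@modn_small (n - j)) ?subKn ?modn_small//; lia.
have notrowE e : E e -> forall x, x \in rows -> ~ (gam x @` C) e.
  by move=> Ee x /rows_labX xX [c Cc ce]; apply: (@label_notE x c) => //; rewrite ce.
have gE e : E e -> g e = e by move=> Ee; apply: gfix; exact: notrowE.
have dE e : E e -> d e = e by move=> Ee; apply: dfix; exact: notrowE.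
have gV1 : fixes_pointwise g V1.
  move=> c V1c; have Cc : C c by case: (V1D _ V1c).
  have := gR 0%N 0%N c isT _ Cc; rewrite (V1f _ V1c) /= subn0 modnn gam00 homeo1.
  by apply; lia.
have dV2 : fixes_pointwise d V2.
  move=> c V2c; have Cc : C c by case: (V2D _ V2c).
  have := dR 0%N 0%N c isT _ Cc; rewrite (V2f _ V2c) subn0 modnn gam00 homeo1.
  by apply; lia.
have gbd : beta = g * d by rewrite /d mulgA -{1}gV mulVg mul1g.
have Gd : G d by exact: subgroupM.
have [v1 V1v] := V10; have [v2 V2v] := V20.
have Cv1 : C v1 by case: (V1D _ V1v).
have Cv2 : C v2 by case: (V2D _ V2v).
have lab_neq j k c : (j < n)%N -> (k < n)%N -> j <> k -> C c ->
    gam [:: 0; j]%N c <> gam [:: 0; k]%N c.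
  move=> jn kn jk Cc e; apply: jk.
  have jX : [:: 0; j]%N \in X by exact: row_labX.
  have kX : [:: 0; k]%N \in X by exact: row_labX.
  by case: (label_disjoint jX kX Cc Cc e).
have [n0 n1] : (0 < n)%N /\ (1 < n)%N by lia.
have [e Ee] := Phi_E0 hch.
have ae : alpha e <> e by move=> aee; apply: (C_notE (alpha_E_C Ee)); rewrite aee.
have ag : alpha <> g by move=> h; apply: ae; rewrite h gE.
have ad : alpha <> d by move=> h; apply: ae; rewrite h dE.
(* Otherwise [beta = g * d] would fix [v1], which it moves from [C] to the piece [01]. *)
have gd : g <> d.
  move=> h; have b1 : beta v1 = v1 by rewrite gbd homeoM -h !gV1.
  have := @lab_neq 0%N 1%N v1 n0 n1; rewrite gam00 -beta_C// b1.
  by move=> /(_ _ Cv1); apply.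
exists g, d; split=> //.
- split.
    (* Over [v1] the map [g] takes label 1 to [n - 1], which is not 1 as [n >= 3]; [d] does the same
       over [v2]. *)
    apply: (@involution_of_square _ (gam [:: 0; 1]%N v1)) => //.
    rewrite gR// (V1f _ V1v) /=; apply: lab_neq => //; first by rewrite ltn_mod.
    by rewrite modn_small; lia.
  apply: (@involution_of_square _ (gam [:: 0; 1]%N v2)) => //.
  rewrite dR// (V2f _ V2v); apply: lab_neq => //; first by rewrite ltn_mod.
  by rewrite modn_small; lia.
- have aG := alpha_G; split.
    have sG : generated [set alpha; g; d] `<=` G.
      by apply: generated_sub => // _ [[->|->]|->].
    apply/seteqP; split=> //; apply: generate_all => //.
    + exact: generated_subgroup.
    + by apply: sub_generated; left; left.
    + rewrite gbd; apply: (subgroupM (generated_subgroup _)).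
        by apply: sub_generated; left; right.
      by apply: sub_generated; right.
  move=> Y YX; have YE1 := YX.1; have [x xX nY] := properset_missing YX.
  case: xX => [[xE|xE]|xE]; rewrite {x}xE in nY.
  + exists E; split; [exact: clopenE|by exists e|move=> h Yh q Eq].
    by case: (YE1 h Yh) => [[hE|->]|->]; [case: nY; rewrite -hE|exact: gE|exact: dE].
  + exists V2; split=> //; move=> h Yh q V2q.
    case: (YE1 h Yh) => [[->|hE]|->]; [|by case: nY; rewrite -hE|exact: dV2].
    by apply: alpha_fixes; exact: V2D.
  + exists V1; split=> //; move=> h Yh q V1q.
    case: (YE1 h Yh) => [[->|->]|hE]; [|exact: gV1|by case: nY; rewrite -hE].
    by apply: alpha_fixes; exact: V1D.
- exact: card_set3.
Qed.

End Phi.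

(** * Orders, restrictions to [C] and generating sets combined *)

Theorem proposition3p3 (m n r : nat) (hm : (2 <= m)%N) (hn : (3 <= n)%N)
  (hr : r = (m * (4 * m + 3 * n - 10)
               * ((m - 1) * (4 * m + 3 * n - 10) + 1))%N)
  (G : set (homeo cantor_space))
  (hG : is_subgroup G) (hsimple : is_simple G) (hvig : vigorous G)
  (C : set cantor_space) (hC : proper_clopen C) (heven : even_class G C)
  (sigma tau : homeo cantor_space) (hS : setS G C (sigma, tau))
  (gam : seq nat -> homeo cantor_space) (E : set cantor_space)
  (alpha beta : homeo cantor_space)
  (hPhi : is_Phi m n G C sigma tau gam E alpha beta) :
  let a := (alpha * beta) ^ (beta ^- 2 * alpha^-1 * beta ^- 2) in
  let b := (alpha * beta) ^ (beta ^- 2 * alpha^-1 * beta^-1) in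
  ((~ Phi_degenerate m n C sigma tau gam E -> small_support G alpha) /\
    has_order alpha m) /\
  (small_support G beta /\ has_order beta n) /\
  stabilises_and_agrees a sigma C /\
  stabilises_and_agrees b tau C /\
  (setSm m G C (sigma, tau) -> [~ a ^+ r, b ^+ r] = [~ sigma ^+ r, tau ^+ r]) /\
  (setSmr m r G C (sigma, tau) ->
     strongly_minimal_generating G [set alpha; beta] /\
     ([set alpha; beta] #= `I_2)%card) /\
  (setSmr m r G C (sigma, tau) ->
     exists gamma delta : homeo cantor_space,
       [/\ G gamma /\ G delta,
           is_involution gamma /\ is_involution delta,
           beta = gamma * delta,
           strongly_minimal_generating G [set alpha; gamma; delta] &
           ([set alpha; gamma; delta] #= `I_3)%card]).

Proof.
move=> a b; have [[Gs ss] [Gt st] _] := hS; rewrite /= in Gs ss Gt st.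
have [hch [pi1 [pi2 [pi3 [[G1 G2 G3 Gb] [e1 e2 e3] eb aE]]]]] := hPhi.
have rE : r = F_exponent m n by rewrite hr.
have [cC _ _] := hC.
have ordE : setSm m G C (sigma, tau) -> (sigma * tau) ^+ m = 1 by move=> [_ []].
split; first by split;
  [exact: (alpha_small_support hm hn hG Gs Gt ss st hch G1 G2 G3 e1 e2 e3 aE cC)
  |exact: (alpha_order hm hn ss st hch e1 e2 e3 aE)].
split; first by split;
  [exact: (beta_small_support hch Gb eb)|exact: (beta_order hm hn hch eb)].
split; first exact: (a_agrees hm hn ss st hch e1 e2 e3 eb aE).
split; first exact: (b_agrees hm hn ss st hch e1 e2 e3 eb aE).
split.
  by move=> /ordE; rewrite rE; exact: (commutator_exponent hm hn ss st hch e1 e2 e3 eb aE).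
(* Order [m >= 2] excludes [sigma * tau = 1], so the copies of [E] do not fill [C]. *)
have st1 : setSm m G C (sigma, tau) -> sigma * tau <> 1.
  by move=> [_ [_ _ /(_ 1%N)]]; rewrite expg1; apply.
split=> -[Sm genC]; rewrite rE.
  exact: (pair_generation hm hn hG Gs Gt ss st hch G1 G2 G3 Gb e1 e2 e3 eb aE hvig hsimple
    cC (st1 Sm) (ordE Sm) genC).
exact: (triple_generation hm hn hG Gs Gt ss st hch G1 G2 G3 Gb e1 e2 e3 eb aE hvig hsimple
  cC heven (st1 Sm) (ordE Sm) genC).
Qed.
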